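(* Let $\mathbf X$ and $\mathbf Y$ be disjoint node sets in an MPDAG $\mathcal G=(\mathbf V,\mathbf E)$. If there is no proper possibly causal path from $\mathbf X$ to $\mathbf Y$ in $\mathcal G$ that starts with an undirected edge, then for any observational density $f$ consistent with $\mathcal G$ (and whichever DAG $\mathcal D$ represented by $\mathcal G$ is used to form the interventional density $f(\cdot\mid do(\mathbf x))$) we have $$f(\mathbf y\mid do(\mathbf x))=\int \prod_{i=1}^{k} f(\mathbf b_i\mid \mathrm{pa}(\mathbf b_i,\mathcal G))\,d\mathbf b,$$ for values $\mathrm{pa}(\mathbf b_i,\mathcal G)$ of $\mathrm{Pa}(\mathbf B_i,\mathcal G)$ that are in agreement with $\mathbf x$, where $(\mathbf B_1,\dots,\mathbf B_k)=\mathrm{PCO}(\mathrm{An}(\mathbf Y,\mathcal G_{\mathbf V\setminus\mathbf X}),\mathcal G)$ and $\mathbf B=\mathrm{An}(\mathbf Y,\mathcal G_{\mathbf V\setminus\mathbf X})\setminus\mathbf Y$.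
   Context: Graphs. A graph $\mathcal G=(\mathbf V,\mathbf E)$ has a finite node set $\mathbf V$ and edges that are directed ($\to$) or undirected ($-$), at most one edge between any two nodes. For $\mathbf V'\subseteq\mathbf V$, $\mathcal G_{\mathbf V'}$ is the induced subgraph on $\mathbf V'$. A path is a sequence of distinct nodes with successive nodes adjacent. A causal path from $X$ to $Y$ is a path all of whose edges point towards $Y$. A path $\langle V_0,\dots,V_k\rangle$, $k\ge1$, is possibly causal if there is no edge $V_i\leftarrow V_j$ in $\mathcal G$ for any $0\le i<j\le k$. A path from a set $\mathbf X$ to a set $\mathbf Y$ is a path from some $X\in\mathbf X$ to some $Y\in\mathbf Y$; it is proper (w.r.t. $\mathbf X$) if only its first node is in $\mathbf X$. A directed cycle is a causal path from $X$ to $Y$ together with $Y\to X$. A PDAG is a graph with directed and undirected edges and no directed cycle; a DAG is a PDAG with only directed edges. $X$ is a parent of $Y$ if $X\to Y$; for a node set $\mathbf S$, $\mathrm{Pa}(\mathbf S,\mathcal G)$ is the set of parents of nodes in $\mathbf S$, minus $\mathbf S$. $\mathrm{An}(\mathbf S,\mathcal G)$ is the set of nodes having a causal path to a node of $\mathbf S$, together with $\mathbf S$ itself. MPDAGs. An unshielded collider is $A\to B\leftarrow C$ with $A,C$ nonadjacent. A DAG $\mathcal D$ is represented by $\mathcal G$ if it has the same adjacencies and the same unshielded colliders as $\mathcal G$ and every directed edge $X\to Y$ of $\mathcal G$ is in $\mathcal D$; $[\mathcal G]$ is the set of all such DAGs. An MPDAG (maximally oriented PDAG) is a PDAG $\mathcal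 G$ with $[\mathcal G]\neq\emptyset$ having none of the following as an induced subgraph: (a) $K\to I$, $I-J$, with $K,J$ nonadjacent; (b) $I\to K\to J$, $I-J$; (c) $K\to J$, $L\to J$, $I-J$, $I-K$, $I-L$, with $K,L$ nonadjacent; (d) $J\to L$, $L\to K$, $I-K$, $I-J$, $I-L$, with $J,K$ nonadjacent. Buckets and PCO. A node set is undirected connected in $\mathcal G$ if every two distinct nodes of it are joined by a path in $\mathcal G$ consisting of undirected edges (the path may leave the set). For $\mathbf D\subseteq\mathbf V$, a bucket in $\mathbf D$ is a maximal undirected connected subset of $\mathbf D$ in $\mathcal G$; the buckets in $\mathbf D$ partition $\mathbf D$ (the bucket decomposition of $\mathbf D$). $\mathrm{PCO}(\mathbf D,\mathcal G)$ is the ordered list produced as follows: start with the collection $\mathbf{ConComp}$ of all buckets in $\mathbf V$ and an empty list; while $\mathbf{ConComp}\ne\emptyset$, pick $\mathbf C\in\mathbf{ConComp}$ such that every edge of $\mathcal G$ between $\mathbf C$ and the nodes of the other buckets still in $\mathbf{ConComp}$ is directed into $\mathbf C$, remove $\mathbf C$ from $\mathbf{ConComp}$, and, if $\mathbf C\cap\mathbf D\neq\emptyset$, add $\mathbf C\cap\mathbf D$ to the beginning of the list; return the list. Densities. Nodes also denote random variables; densities of $\mathbf V$ are with respect to a product dominating measure. A density $f$ of $\mathbf V$ is an observational density consistent with a DAG $\mathcal D=(\mathbf V,\mathbf E)$ if $f(\mathbf v)=\prod_{V_i\in\mathbf V}f(v_i\mid \mathrm{pa}(v_i,\mathcal D))$;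 it is consistent with an MPDAG $\mathcal G$ if it is consistent with some DAG in $[\mathcal G]$. Given $f$ consistent with $\mathcal D$, $\mathbf X\subset\mathbf V$ and $\mathbf V'=\mathbf V\setminus\mathbf X$, the interventional density is $f(\mathbf v'\mid do(\mathbf x))=\prod_{V_i\in\mathbf V'}f(v_i\mid\mathrm{pa}(v_i,\mathcal D))$ for values $\mathrm{pa}(v_i,\mathcal D)$ of $\mathrm{Pa}(V_i,\mathcal D)$ in agreement with $\mathbf x$ (coordinates belonging to $\mathbf X$ are set to their values in $\mathbf x$), and $f(\mathbf v\mid do(\emptyset))=f(\mathbf v)$; for $\mathbf Y\subseteq\mathbf V'$, $f(\mathbf y\mid do(\mathbf x))$ is its marginal density of $\mathbf Y$. Identities are understood where the conditional densities involved are well defined. *)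

(* Defs.v *)
From HB Require Import structures.
From mathcomp Require Import all_boot all_order all_algebra.
From mathcomp Require Import all_classical all_reals all_analysis.
Set Implicit Arguments.
Unset Strict Implicit.
Unset Printing Implicit Defensive.
Import Order.TTheory GRing.Theory Num.Theory.
Local Open Scope ring_scope.

(** * Graphs *)

Record graph (V : finType) := Graph {
  dir : rel V;
  und : rel V;
  und_sym : symmetric und;
  und_irr : irreflexive und;
  (* at most one edge between two nodes; with x = y it also forbids loops *)
  dir_excl : forall x y, dir x y -> ~~ dir y x && ~~ und x y }.

Section Graphs.
Variable V : finType.
Implicit Types (G D : graph V) (S X Y B : {set V}) (L : seq {set V}).

Definition adj G : rel V := fun x y => [|| dir G x y, dir G y x | und G x y].

(* G_S, kept on the node type V: the nodes outside S become isolated. *)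
Definition induced_dir G S : rel V := fun x y => [&& x \in S, y \in S & dir G x y].
Definition induced_und G S : rel V := fun x y => [&& x \in S, y \in S & und G x y].

Fact induced_sym G S : symmetric (induced_und G S).
Proof. by move=> x y; rewrite /induced_und und_sym andbCA. Qed.

Fact induced_irr G S : irreflexive (induced_und G S).
Proof. by move=> x; rewrite /induced_und und_irr !andbF. Qed.

Fact induced_excl G S x y :
  induced_dir G S x y -> ~~ induced_dir G S y x && ~~ induced_und G S x y.
Proof.
by case/and3P=> xS yS /dir_excl; rewrite /induced_dir /induced_und xS yS.
Qed.

Definition induced_subgraph G S : graph V :=
  Graph (@induced_sym G S) (@induced_irr G S) (@induced_excl G S).

(* In what follows the path <x, p_1, ..., p_k> is given by x and p. *)
Definition gpath G (x : V) (p : seq V) : bool :=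
  path (adj G) x p && uniq (x :: p).

Definition causal_path G (x : V) (p : seq V) : bool :=
  path (dir G) x p && uniq (x :: p).

Definition possibly_causal G (x : V) (p : seq V) : bool :=
  [&& gpath G x p, p != [::] & pairwise (fun u v => ~~ dir G v u) (x :: p)].

Definition proper_wrt X (p : seq V) : bool := all (fun v => v \notin X) p.

Definition starts_undirected G (x : V) (p : seq V) : bool :=
  if p is y :: _ then und G x y else false.

Definition Pa S G : {set V} := [set v | (v \notin S) && [exists s in S, dir G v s]].

Definition An S G : {set V} :=
  S :|: [set v | `[< exists p, causal_path G v p /\ last v p \in S >]].

Definition pdag G : Prop :=
  forall x p, causal_path G x p -> ~~ dir G (last x p) x.

Definition dag D : Prop := pdag D /\ forall x y, ~~ und D x y.

Definition unshielded_collider G (a b c : V) : bool :=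
  [&& dir G a b, dir G c b, a != c & ~~ adj G a c].

Definition represented G D : Prop :=
  [/\ dag D, adj D =2 adj G,
      forall a b c, unshielded_collider D a b c = unshielded_collider G a b c
    & forall x y, dir G x y -> dir D x y].

Definition forbidden_a G (i j k : V) : bool :=
  [&& dir G k i, und G i j & ~~ adj G k j].

Definition forbidden_b G (i j k : V) : bool :=
  [&& dir G i k, dir G k j & und G i j].

Definition forbidden_c G (i j k l : V) : bool :=
  [&& k != l, dir G k j, dir G l j, und G i j, und G i k, und G i l
    & ~~ adj G k l].

Definition forbidden_d G (i j k l : V) : bool :=
  [&& dir G j l, dir G l k, und G i k, und G i j, und G i l & ~~ adj G j k].

Definition mpdag G : Prop :=
  [/\ pdag G, exists D, represented G D,
      forall i j k, ~~ forbidden_a G i j k /\ ~~ forbidden_b G i j k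
    & forall i j k l, ~~ forbidden_c G i j k l /\ ~~ forbidden_d G i j k l].

(* [connect] is reflexive, which is harmless: only distinct nodes matter. *)
Definition und_connected G S : bool :=
  [forall x in S, forall y in S, connect (und G) x y].

(* Nonemptiness only matters for an empty S, which has no bucket. *)
Definition bucket G S B : bool :=
  (B != finset.set0) && maxset (fun B' => (B' \subset S) && und_connected G B') B.

Definition buckets G S : {set {set V}} := [set B | bucket G S B].

(* [C] can be picked when [CC] is the current collection ConComp *)
Definition pickable G (CC : {set {set V}}) (C : {set V}) : Prop :=
  C \in CC /\
  forall C' u v, C' \in CC -> C' != C -> u \in C -> v \in C' ->
    adj G v u -> dir G v u.

(* [pco_loop G S CC L L']: from the collection [CC] and the list [L] the loop
   can end with the list [L']. *)
Inductive pco_loop G S : {set {set V}} -> seq {set V} -> seq {set V} -> Prop :=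
| pco_stop L : pco_loop G S finset.set0 L L
| pco_step CC C L L' : pickable G CC C ->
    pco_loop G S (CC :\ C) (if C :&: S != finset.set0 then C :&: S :: L else L) L' ->
    pco_loop G S CC L L'.

(* The choices in the loop are not determined, so that PCO is a relation. *)
Definition PCO S G L : Prop := pco_loop G S (buckets G [set: V]) [::] L.

(* A factor f(b | a) of a product of conditional densities is the pair (B, A). *)
Definition dag_factors D S : seq ({set V} * {set V}) :=
  [seq ([set v], Pa [set v] D) | v <- enum S].

Definition bucket_factors G L : seq ({set V} * {set V}) :=
  [seq (B, Pa B G) | B <- L].

End Graphs.

(** * Densities *)

Section Densities.
Variables (R : realType) (V : finType) (d : V -> measure_display).
Variable T : forall v, measurableType (d v).
Variable mu : forall v, {sigma_finite_measure set (T v) -> \bar R}.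

Definition coordinate_events : set (set (forall v, T v)) :=
  [set E | exists v (A : set (T v)), measurable A /\ E = [set w | A (w v)]]%classic.

(* Joint values of all the variables, with the product sigma-algebra. *)
Definition values := g_sigma_algebraType coordinate_events.

Implicit Types (w : values) (S A B X Y : {set V}) (f : values -> R).

Fixpoint iterated_integral (s : seq V) (F : values -> \bar R) w : \bar R :=
  if s is v :: s' then
    (\int[mu v]_x iterated_integral s' F (@dfwith V T w v x))%E
  else F w.

(* Integral over the coordinates in S, the others being fixed by w; it is only
   used for nonnegative measurable F, where by Tonelli the order of the
   variables is irrelevant and this is the integral for the product of the mu. *)
Definition integral_over S (F : values -> \bar R) w : \bar R :=
  iterated_integral (enum S) F w.

Definition agree_on S w w' : Prop := forall v, v \in S -> w' v = w v.

(* P holds for almost all values of the coordinates in S, the others being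
   fixed by w. *)
Definition almost_all S w (P : values -> Prop) : Prop :=
  exists N : set values,
    [/\ measurable N, integral_over S (fun w' => (\1_N w')%:E) w = 0%E
      & forall w', agree_on (~: S) w w' -> ~ P w' -> N w'].

Definition density f : Prop :=
  [/\ measurable_fun [set: values]%classic f, forall w, 0 <= f w
    & forall w, integral_over [set: V] (EFin \o f) w = 1%E].

(* f(a), which depends on w through its coordinates in A only *)
Definition marginal f A w : \bar R := integral_over (~: A) (EFin \o f) w.

(* f(b | a) at w. Where it is not defined this is a junk value, which is 0
   because so are [fine +oo] and [_ / 0]. *)
Definition cond f B A w : R :=
  fine (marginal f (B :|: A) w) / fine (marginal f A w).

Definition cond_defined f A w : Prop := (0 < marginal f A w < +oo)%E.

Definition cond_prod f (s : seq ({set V} * {set V})) w : R :=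
  \prod_(c <- s) cond f c.1 c.2 w.

(* A product of conditional densities is meaningful if all its factors are
   defined, or if one of its defined factors vanishes. *)
Definition cond_prod_defined f (s : seq ({set V} * {set V})) w : Prop :=
  (forall c, c \in s -> cond_defined f c.2 w) \/
  (exists c, [/\ c \in s, cond_defined f c.2 w & cond f c.1 c.2 w = 0]).

(* Densities are functions up to null sets. Almost everywhere, f vanishes
   where one of the f(pa(v, D)) does, so that junk values do not matter. *)
Definition consistent_dag f (D : graph V) : Prop :=
  density f /\
  forall w0, almost_all [set: V] w0
    (fun w => f w = cond_prod f (dag_factors D [set: V]) w).

Definition consistent f (G : graph V) : Prop :=
  exists D, represented G D /\ consistent_dag f D.

(* f(v' | do(x)), where w gives both v' and x *)
Definition do_density f (D : graph V) X w : R :=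
  if X == finset.set0 then f w else cond_prod f (dag_factors D (~: X)) w.

(* f(y | do(x)) *)
Definition do_marginal f (D : graph V) X Y w : \bar R :=
  integral_over (~: (X :|: Y)) (EFin \o do_density f D X) w.

End Densities.

(* Main.v *)
(* Let Z be the set of nodes with a path to Y in D that avoids X; it contains
   A = An(Y, G_{V \ X}). In the truncated product of the f(v | pa(v, D)) the
   nodes outside Z integrate to 1 one after the other, starting with the sinks,
   which leaves the product over Z. Group it by the undirected components C of
   G. All nodes of C have the same parents P outside C, so that the conditional
   density of Z \cap C given P is the product over Z \cap C as soon as no node
   of X \cap C is a D-parent of Z \cap C; the hypothesis on possibly causal
   paths says just that. Integrating over (Z \cap C) \ A leaves
   f(C \cap A | P), and P is Pa(C \cap A, G).
   That f factorizes over D and not only over the DAG it is consistent with is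
   an identity between products of marginals: writing the marginals as products
   of a Moebius transform, the product over a DAG only depends on the
   characteristic imset, which only depends on the adjacencies and the
   unshielded colliders. *)

Require Import Defs.
From mathcomp Require Import all_boot all_order all_algebra.
From mathcomp Require Import boolp.
Set Implicit Arguments.
Unset Strict Implicit.
Unset Printing Implicit Defensive.
Import Order.TTheory GRing.Theory Num.Theory.
Local Open Scope ring_scope.

(** * Directed acyclic graphs and Markov equivalence *)

Section Dags.
Variable V : finType.
Implicit Types (G D : graph V) (S T X Y A B C : {set V}).

(** Two obstacles shape the proof. The identity between products of marginals divides by marginals,
    so it is available only where [f] is positive. What is clear almost everywhere is that [f] is at
    most its product over [D]. This suffices: the product integrates to at most 1 and the marginals
    of [f] to 1, so equality holds for the marginals of all parent-closed sets, and conditional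
    densities are read off from such sets. The second obstacle is that the values x may be
    improbable under [f]. A factor f(v | pa) that is not defined integrates to 0 and not to 1, and
    the nodes outside Z can then fail to integrate out. Definedness on the slice with x fixed
    repairs exactly this step. The identities for single components hold almost everywhere because
    both sides are 0 where f(P) is not defined. Statements about almost all points, almost all
    slices and almost all points of a slice have to be converted into each other all along. *)

Lemma dir_irr G x : dir G x x = false.
Proof. by apply/negP => /[dup] xx /dir_excl; rewrite xx. Qed.

Lemma dir_asym G x y : dir G x y -> dir G y x = false.
Proof. by case/dir_excl/andP => /negbTE. Qed.

Lemma dir_und G x y : dir G x y -> und G x y = false.
Proof. by case/dir_excl/andP => _ /negbTE. Qed.

Lemma und_dir G x y : und G x y -> dir G x y = false.
Proof. by move=> u; apply/negP => /dir_und; rewrite u. Qed.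

Lemma und_dir' G x y : und G x y -> dir G y x = false.
Proof. by rewrite und_sym; exact: und_dir. Qed.

Lemma adj_sym G x y : adj G x y = adj G y x.
Proof. by rewrite /adj orbCA und_sym. Qed.

Lemma mem_Pa1 G u v : (u \in Pa [set v] G) = dir G u v.
Proof.
rewrite !inE; apply/andP/idP => [[_ /exists_inP[w]]|uv].
  by rewrite inE => /eqP->.
split; first by apply: contraTneq uv => ->; rewrite dir_irr.
by apply/exists_inP; exists v; rewrite ?inE.
Qed.

Lemma dag_acyclic D x y : dag D -> connect (dir D) x y -> dir D y x = false.
Proof.
move=> [ac _] /connectP[p pp ->]; case/shortenP: pp => q qq uq _.
by apply/negbTE/ac; rewrite /causal_path qq uq.
Qed.

(** The number of descendants is a topological rank: its minimizers in a node set are sinks of the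
    set, its maximizers are sources. *)
Lemma dag_rank D x y : dag D -> dir D x y ->
  (#|[set u | connect (dir D) y u]| < #|[set u | connect (dir D) x u]|)%N.
Proof.
move=> dD xy; apply: proper_card; apply/properP; split.
  by apply/subsetP => u; rewrite !inE; exact: connect_trans (connect1 xy).
exists x; rewrite !inE ?connect0 //; apply/negP => /(dag_acyclic dD).
by rewrite xy.
Qed.

Lemma dag_sink D S v0 : dag D -> v0 \in S ->
  exists2 v, v \in S & forall u, u \in S -> dir D v u = false.
Proof.
move=> dD v0S.
case: (@arg_minnP _ v0 (mem S) (fun v => #|[set u | connect (dir D) v u]|) v0S).
move=> v vS h; exists v => // u uS; apply/negP => /(dag_rank dD).
by rewrite ltnNge; move/negP; apply; exact: h.
Qed.

Lemma dag_source D S v0 : dag D -> v0 \in S ->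
  exists2 v, v \in S & forall u, u \in S -> dir D u v = false.
Proof.
move=> dD v0S.
case: (@arg_maxnP _ v0 (mem S) (fun v => #|[set u | connect (dir D) v u]|) v0S).
move=> v vS h; exists v => // u uS; apply/negP => /(dag_rank dD).
by rewrite ltnNge; move/negP; apply; exact: h.
Qed.

(* Studeny's characteristic imset: T is counted at the node v of T all of
   whose companions are parents of v. *)
Definition imset_at D T v := (v \in T) && (T \subset v |: Pa [set v] D).

Lemma imset_at_uniq D T u v : imset_at D T u -> imset_at D T v -> u = v.
Proof.
move=> /andP[uT /subsetP su] /andP[vT /subsetP sv]; apply/eqP/negPn/negP => uv.
have := su v vT; have := sv u uT; rewrite !in_setU1 !mem_Pa1 (negbTE uv).
by rewrite eq_sym (negbTE uv) /= => /dir_asym ->.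
Qed.

(** The new node is a sink of [T] in [D']. A companion not adjacent to it would form with it an
    unshielded collider at [v]; as [D'] shares this collider, the sink would point to [v]. *)
Lemma imset_at_transfer D D' T v : dag D -> dag D' -> adj D =2 adj D' ->
  (forall a b c, unshielded_collider D a b c = unshielded_collider D' a b c) ->
  imset_at D T v -> exists t, imset_at D' T t.
Proof.
move=> dD dD' ea ec /andP[vT /subsetP sv].
have [t tT ht] := dag_sink dD' vT.
exists t; apply/andP; split => //; apply/subsetP => c cT.
rewrite in_setU1 mem_Pa1; case: eqVneq => //= ct.
have dirE E : dag E -> forall x y, adj E x y = dir E x y || dir E y x.
  by move=> [_ nu] x y; rewrite /adj (negbTE (nu x y)) orbF.
suff : adj D' c t by rewrite dirE // (ht c cT) orbF.
have vP u : u \in T -> u != v -> dir D u v.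
  by move=> /sv; rewrite in_setU1 mem_Pa1 => /orP[->|].
rewrite -ea; have [e|tv] := eqVneq t v.
  by rewrite {}e in ct *; rewrite /adj vP.
have [->|cv] := eqVneq c v.
  by rewrite adj_sym /adj vP.
apply: contraFT (ht v vT) => nadj.
have : unshielded_collider D c v t by rewrite /unshielded_collider !vP // ct nadj.
by rewrite ec => /and4P[].
Qed.

Lemma card_imset_at D D' T : dag D -> dag D' -> adj D =2 adj D' ->
  (forall a b c, unshielded_collider D a b c = unshielded_collider D' a b c) ->
  #|[pred v | imset_at D T v]| = #|[pred v | imset_at D' T v]|.
Proof.
move=> dD dD' ea ec.
have le1 E : (#|[pred v | imset_at E T v]| <= 1)%N.
  apply/card_le1P => v; rewrite inE => hv u; rewrite !inE.
  by apply/idP/eqP => [hu|->//]; exact: imset_at_uniq hu hv.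
have ex : (exists v, imset_at D T v) <-> (exists v, imset_at D' T v).
  by split=> -[v]; apply: imset_at_transfer => // *; rewrite ?ea ?ec.
have pos E : (0 < #|[pred v | imset_at E T v]|)%N <-> exists v, imset_at E T v.
  by split=> [/card_gt0P[v]|[v h]]; [exists v|apply/card_gt0P; exists v].
have [h|h] := posnP #|[pred v | imset_at D T v]|;
  have [h'|h'] := posnP #|[pred v | imset_at D' T v]|.
- by rewrite h h'.
- by move/pos/ex/pos: h'; rewrite h.
- by move/pos/ex/pos: h; rewrite h'.
- by apply/eqP; rewrite eqn_leq (leq_trans (le1 D)) // (leq_trans (le1 D')).
Qed.

(** Multiplicative Moebius inversion, by recursion on the cardinality instead of the alternating
    formula: [b S] is [a S] divided by the product of [b] over the proper subsets. *)
Lemma moebius_prod (F : fieldType) (a : {set V} -> F) : (forall S, a S != 0) ->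
  exists b : {set V} -> F, (forall S, b S != 0) /\
    forall S, a S = \prod_(T : {set V} | T \subset S) b T.
Proof.
move=> a0.
suff /(_ #|V|.+1)[b [b0 hb]] : forall n, exists b : {set V} -> F, (forall S, b S != 0) /\
    forall S, (#|S| < n)%N -> a S = \prod_(T : {set V} | T \subset S) b T.
  by exists b; split => // S; apply: hb; rewrite ltnS max_card.
elim=> [|n [b [b0 hb]]]; first by exists (fun=> 1); split=> // S; exact: oner_neq0.
exists (fun S => if (#|S| == n)%N then a S / \prod_(T : {set V} | T \proper S) b T else b S).
split=> [S|S].
  by case: ifP => // _; rewrite mulf_neq0 // invr_neq0 //; apply/prodf_neq0.
rewrite ltnS leq_eqVlt => /predU1P[Sn|Sn]; last first.
  rewrite hb //; apply: eq_bigr => T TS; rewrite ifN //.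
  by rewrite neq_ltn (leq_ltn_trans (subset_leq_card TS)).
rewrite (bigD1 S) //= Sn eqxx.
rewrite [X in _ * X](_ : _ = \prod_(T : {set V} | T \proper S) b T).
  by rewrite divfK //; apply/prodf_neq0.
apply: eq_big => [T|T /andP[TS neq]]; first by rewrite properEneq andbC.
by rewrite ifN // neq_ltn -Sn proper_card // properEneq neq.
Qed.

(** In the quotient at [v] the subsets of the parents cancel; there remain the subsets containing
    [v], which are the [T] counted at [v] by the imset. So the exponent of [b T] is the count of
    [T], which both graphs share. *)
Lemma markov_equiv_prod (F : fieldType) (a : {set V} -> F) D D' :
  dag D -> dag D' -> adj D =2 adj D' ->
  (forall x y z, unshielded_collider D x y z = unshielded_collider D' x y z) ->
  (forall S, a S != 0) ->
  \prod_v (a (v |: Pa [set v] D) / a (Pa [set v] D)) =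
  \prod_v (a (v |: Pa [set v] D') / a (Pa [set v] D')).
Proof.
move=> dD dD' ea ec a0; have [b [b0 hb]] := moebius_prod a0.
suff h E : \prod_v (a (v |: Pa [set v] E) / a (Pa [set v] E)) =
    \prod_(T : {set V}) b T ^+ #|[pred v | imset_at E T v]|.
  by rewrite !h; apply: eq_bigr => T _; rewrite (card_imset_at _ dD dD').
under [RHS]eq_bigr do rewrite -prodr_const.
rewrite (exchange_big_dep predT) //=; apply: eq_bigr => v _.
apply: (mulIf (a0 (Pa [set v] E))); rewrite mulfVK //.
rewrite (hb (v |: _)) (bigID (fun T : {set V} => v \in T)) /= (hb (Pa _ E)).
congr (_ * _); apply: eq_bigl => T; first by rewrite inE andbC.
by rewrite -subsetD1 setU1K // mem_Pa1 dir_irr.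
Qed.

End Dags.

(** * Possibly causal paths in MPDAGs *)

Section Sequences.
Variable V : eqType.
Implicit Types (e r : rel V) (l s : seq V).

Lemma split_last (a : pred V) s : has a s ->
  exists s1 v s2, [/\ s = s1 ++ v :: s2, a v & ~~ has a s2].
Proof.
elim: s => //= u s IH; have [hs _|hs] := boolP (has a s).
  by have [s1 [v [s2 [-> av h]]]] := IH hs; exists (u :: s1), v, s2.
by rewrite orbF => au; exists [::], u, s.
Qed.

Lemma pairwise_split r s :
  (forall a q b p c, s = a ++ q :: b ++ p :: c -> r q p) -> pairwise r s.
Proof.
elim: s => //= q s IH h; apply/andP; split.
  apply/allP => p ps; move: h; case/path.splitPr: ps => b c h.
  exact: (h [::] q b p c).
by apply: IH => a q' b p c e; apply: (h (q :: a) q' b p c); rewrite e.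
Qed.

End Sequences.

Lemma shortest_path (V : finType) (e : rel V) x y : connect e x y ->
  exists l, [/\ path e x l, last x l = y, uniq (x :: l) &
    forall l', path e x l' -> last x l' = y -> (size l <= size l')%N].
Proof.
move=> /connectP[p0 pp0 lp0].
pose P n := [exists t : n.-tuple V, path e x t && (last x t == y)].
have PP l : path e x l -> last x l = y -> P (size l).
  by move=> pl ll; apply/existsP; exists (in_tuple l); rewrite /= pl ll eqxx.
have exP : exists n, P n by exists (size p0); exact: PP.
case: (ex_minnP exP) => n /existsP[t /andP[pt /eqP lt]] mn.
case: (shortenP pt) lt => l pl ul sl ll.
have sz : (size l <= n)%N.
  by rewrite -(size_tuple t); move: ul => /= /andP[_ ul]; exact: uniq_leq_size.
exists l; split=> // l' pl' ll'; exact: (leq_trans sz (mn _ (PP _ pl' ll'))).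
Qed.

Section Mpdags.
Variable V : finType.
Variables (G D : graph V) (X Y : {set V}).
Hypotheses (mpG : mpdag G) (rep : represented G D).
Implicit Types (x y u v w : V) (S C : {set V}).

Let dD : dag D. Proof. by case: rep. Qed.

Lemma rule_a k i j : dir G k i -> und G i j -> adj G k j.
Proof.
move=> ki ij; have [_ _ h _] := mpG; have [+ _] := h i j k.
by rewrite /forbidden_a ki ij /= negbK.
Qed.

Lemma rule_b i k j : dir G i k -> dir G k j -> und G i j = false.
Proof.
move=> ik kj; have [_ _ h _] := mpG; have [_] := h i j k.
by rewrite /forbidden_b ik kj /= => /negbTE.
Qed.

(** Rule (a) makes [u] and [c'] adjacent, and rule (b) excludes the direction from [c'] to [u],
    which would give a directed detour for the undirected edge between [c'] and [c]. *)
Lemma dir_und_step u c c' : dir G u c -> und G c c' -> dir G u c' \/ und G u c'.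
Proof.
move=> uc cc'; have /or3P[|c'u|] := rule_a uc cc'; [by left| |by right].
by have := rule_b c'u uc; rewrite und_sym cc'.
Qed.

Lemma dirG_D u v : dir G u v -> dir D u v.
Proof. by case: rep => _ _ _; apply. Qed.

Lemma dirD_G u v : dir D u v -> dir G u v \/ und G u v.
Proof.
move=> uv; have [_ ea _ _] := rep.
have : adj D u v by rewrite /adj uv.
rewrite ea => /or3P[|/dirG_D|]; [by left| |by right].
by rewrite dir_asym.
Qed.

Lemma adjD u v : adj G u v -> dir D u v \/ dir D v u.
Proof.
have [[_ nu] ea _ _] := rep; rewrite -ea /adj (negbTE (nu u v)) orbF => /orP[]; tauto.
Qed.

Lemma und_connect_sym : connect_sym (und G).
Proof. exact/sym_connect_sym/und_sym. Qed.

(** An arrow from outside travels along undirected edges: at each step the alternative in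
    [dir_und_step] would put [u] into the component. *)
Lemma dir_component u c c' : dir G u c -> connect (und G) c c' ->
  ~~ connect (und G) u c -> dir G u c'.
Proof.
move=> + /connectP[p pp ->]; elim: p c pp => //= c1 p IH c /andP[cc1 pp] uc nuc.
have [uc1|uc1] := dir_und_step uc cc1.
  apply: IH => //; apply: contra nuc => h; apply: connect_trans h _.
  by rewrite connect1 // und_sym.
by case/negP: nuc; apply: connect_trans (connect1 uc1) _; rewrite connect1 // und_sym.
Qed.

Definition avoiding_ancestors : {set V} :=
  [set v | [exists y in Y, connect (induced_dir D (~: X)) v y]].
Local Notation Z := avoiding_ancestors.

Hypothesis dXY : [disjoint X & Y].
Hypothesis no_path : ~ (exists (x : V) (p : seq V),
       [/\ x \in X, last x p \in Y, possibly_causal G x p, proper_wrt X p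
         & starts_undirected G x p]).

Lemma avoiding_path v : v \in Z -> exists p, [/\ path (dir D) v p, uniq (v :: p),
  last v p \in Y & all (fun u => u \notin X) (v :: p)].
Proof.
rewrite inE => /exists_inP[y yY /connectP[p pp yp]].
case/shortenP: pp yp => q qq uq _ yq; rewrite {}yq in yY; exists q.
have qD : path (dir D) v q by apply: sub_path qq => a b /and3P[].
split => //; elim: q v {uq qD} qq yY => [|u q IH] v /=.
  by move=> _ vY; rewrite (disjointFl dXY vY).
by move=> /andP[/and3P[vX _ _] uq] lq; rewrite inE in vX; rewrite vX; exact: IH.
Qed.

(* Take the last node v on the directed path from x to Y that is adjacent to x
   and in the undirected component of x, and a shortest undirected path l from
   x to v. Rules (a) and (b) show that x points to all nodes of l but possibly
   the first, so that l followed by the rest of the directed path is possibly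
   causal. *)
Lemma no_edge_within_component x v1 : x \in X -> v1 \in Z -> dir D x v1 ->
  connect (und G) x v1 -> False.
Proof.
move=> xX v1Z xv1 cxv1; apply: no_path.
have [p1 [pp1 up1 lp1 Xp1]] := avoiding_path v1Z.
pose near u := adj G x u && connect (und G) x u.
have [s1 [v [s2 [es nv ns2]]]] : exists s1 v s2,
    [/\ v1 :: p1 = s1 ++ v :: s2, near v & ~~ has near s2].
  apply: split_last; rewrite /= /near cxv1 andbT.
  have [_ ea _ _] := rep; by rewrite -ea /adj xv1.
have vs2 : path (dir D) v s2.
  have : sorted (dir D) (v1 :: p1) by [].
  by rewrite es => /cat_sorted2[].
have us2 : uniq (v :: s2) by move: up1; rewrite es cat_uniq => /and3P[].
have ls2 : last v s2 \in Y.
  by move: lp1; rewrite -[last v1 p1]/(last v1 (v1 :: p1)) es last_cat.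
have Xs2 : all (fun u => u \notin X) (v :: s2).
  by move: Xp1; rewrite es all_cat => /andP[].
have dxv : connect (dir D) x v.
  have : v \in v1 :: p1 by rewrite es mem_cat mem_head orbT.
  move=> vin; apply: connect_trans (connect1 xv1) _.
  exact: (path_connect pp1).
have dvs w : w \in s2 -> connect (dir D) v w.
  by move=> ws; apply: (path_connect vs2); rewrite inE ws orbT.
have dxs w : w \in s2 -> connect (dir D) x w.
  by move=> /dvs; exact: connect_trans.
have vX : v \notin X by move: Xs2 => /andP[].
have xv : dir D x v.
  by case/andP: nv => /adjD[//|vx] _; rewrite (dag_acyclic dD dxv) in vx.
case/andP: nv => nxv cxv.
have [l [pl ll ul minl]] := shortest_path cxv.
(* An undirected edge joins only consecutive nodes of [l], as any other one would be a shortcut. *)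
have chord a q b p c : l = a ++ q :: b ++ p :: c -> und G q p -> b = [::].
  move=> el qp; case: b el => // b0 b el.
  have := minl (a ++ q :: p :: c).
  move: pl ll; rewrite el !cat_path !last_cat /= cat_path last_cat /= qp.
  move=> /and5P[-> -> _ _ /andP[_ ->]] -> /(_ isT erefl).
  by rewrite !size_cat /= !size_cat /= leq_add2l !ltnS -addSnnS leqNgt ltnS leq_addl.
have chordx b p c : l = b ++ p :: c -> und G x p -> b = [::].
  move=> el xp; case: b el => // b0 b el.
  have := minl (p :: c); move: pl ll; rewrite el /= cat_path last_cat /= xp.
  move=> /and4P[_ _ _ ->] -> /(_ isT erefl).
  by rewrite size_cat /= ltnNge leq_addl.
have edge a q p c : l = a ++ q :: p :: c -> und G q p.
  by move=> el; move: pl; rewrite el cat_path /= => /and4P[].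
have comp_l u : u \in l -> connect (und G) x u.
  by move=> ul'; apply: (path_connect pl); rewrite inE ul' orbT.
(* Backwards from [v]: once [x] points to the next node, it has an arrow or an undirected edge to
   [u], and the latter is a shortcut unless [u] comes first. *)
have C1 c : forall a u, l = a ++ u :: c -> dir G x u \/ (a = [::] /\ und G x u).
  elim: c => [|u' c IH] a u el.
    have eu : u = v by rewrite -ll el last_cat.
    rewrite eu in el *; case: (dirD_G xv) => [|uxv]; [by left|right].
    by split=> //; exact: chordx el uxv.
  have [xu'|[]] := IH (rcons a u) u' ltac:(by rewrite cat_rcons); last by case: (a).
  have := edge _ _ _ _ el; rewrite und_sym => /(dir_und_step xu')[|xu]; [by left|right].
  by split=> //; exact: chordx el xu.
(* The head of a backward arrow from [p] can be moved towards the front of [l], since an undirected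
   edge instead would be a shortcut. At the first node [q], the arrows from [x] to [p] and from [p]
   to [q] contradict rule (b) for the edge between [x] and [q]. *)
have C2 a : forall q b p c, l = a ++ q :: b ++ p :: c -> dir G p q = false.
  elim/last_ind: a => [|a q' IH] q b p c el; apply/negP => pq.
    have xq : und G x q by move: pl; rewrite el => /andP[].
    have [xp|[]//] := C1 c (q :: b) p el.
    by have := rule_b xp pq; rewrite xq.
  rewrite cat_rcons in el.
  have := edge _ _ _ _ el; rewrite und_sym => /(dir_und_step pq)[pq'|].
    by have := IH q' (q :: b) p c el; rewrite pq'.
  by rewrite und_sym => /(chord _ _ (q :: b) _ _ el).
(* If [w] is outside the component, it would point to [v] as well, closing a cycle in [D]. If it is
   inside, it is not adjacent to [x] by the choice of [v]; the head of the arrow then moves on to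
   [v], because an undirected edge between [w] and a child [u'] of [x] would force the adjacency by
   rule (a). *)
have C3 w : w \in s2 -> forall c a u, l = a ++ u :: c -> dir G w u = false.
  move=> ws; have [cxw|cxw] := boolP (connect (und G) x w); last first.
    move=> c a u el; apply/negP => wu.
    have xu : connect (und G) x u by apply: comp_l; rewrite el mem_cat mem_head orbT.
    have ux : connect (und G) u x by rewrite und_connect_sym.
    have : dir G w v.
      apply: (dir_component wu); first exact: connect_trans cxv.
      apply: contra cxw => wu'; apply: connect_trans xu _.
      by rewrite und_connect_sym.
    by move/dirG_D; rewrite (dag_acyclic dD (dvs _ ws)).
  have nxw : adj G x w = false.
    by apply: contraNF ns2 => xw; apply/hasP; exists w => //; rewrite /near xw.
  elim=> [|u' c IH] a u el; apply/negP => wu.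
    have eu : u = v by rewrite -ll el last_cat.
    by move/dirG_D: wu; rewrite eu (dag_acyclic dD (dvs _ ws)).
  have el' : l = rcons a u ++ u' :: c by rewrite cat_rcons.
  have [wu'|wu'] := dir_und_step wu (edge _ _ _ _ el).
    by have := IH _ _ el'; rewrite wu'.
  have [xu'|[]] := C1 _ _ _ el'; last by case: (a).
  by rewrite und_sym in wu'; have := rule_a xu' wu'; rewrite nxw.
have lsplit u : u \in l -> exists a c, l = a ++ u :: c.
  by case/path.splitPr => a c; exists a, c.
have upath : uniq (x :: l ++ s2).
  have us2' : uniq s2 by case/andP: us2.
  rewrite -cat_cons cat_uniq ul us2' andbT /=.
  apply/hasPn => w ws; rewrite inE negb_or; apply/andP; split.
    apply: contraTneq xX => <-; exact: (allP Xs2) (mem_behead (s := v :: s2) ws).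
  apply/negP => wl; case/negP: ns2; apply/hasP; exists w => //.
  rewrite /near comp_l // andbT; have [a [c el]] := lsplit _ wl.
  by rewrite /adj; case: (C1 _ _ _ el) => [->//|[_ ->]]; rewrite !orbT.
have nback : pairwise (fun u v => ~~ dir G v u) (x :: l ++ s2).
  rewrite pairwise_cons pairwise_cat all_cat; apply/and4P; split.
  - apply/andP; split; apply/allP => w ws.
      have [a [c el]] := lsplit _ ws.
      by case: (C1 _ _ _ el) => [/dir_asym->//|[_ /und_dir'->]].
    by apply/negP => /dirG_D; rewrite (dag_acyclic dD (dxs _ ws)).
  - apply/allrelP => u w /lsplit[a [c el]] ws; by rewrite (C3 w ws c a u el).
  - by apply: pairwise_split => a q b p c el; rewrite (C2 _ _ _ _ _ el).
  - elim: (s2) (v) vs2 => //= w s IH w0 /andP[_ pws]; rewrite (IH w) // andbT.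
    apply/allP => u us; apply/negP => /dirG_D.
    by rewrite (dag_acyclic dD) // (path_connect pws) // inE us orbT.
(* For properness the path is restarted at the last node of [X] on it. As [v] is not in [X], at
   least one undirected edge remains at the start. *)
have [l1 [x' [l2 [exl x'X nl2]]]] : exists l1 x' l2,
    [/\ x :: l = l1 ++ x' :: l2, x' \in X & ~~ has (mem X) l2].
  by apply: (@split_last _ (mem X)); rewrite /= xX.
have pl2 : path (und G) x' l2.
  by have : sorted (und G) (x :: l) by []; rewrite exl => /cat_sorted2[].
have ll2 : last x' l2 = v.
  by rewrite -ll -[last x l]/(last x (x :: l)) exl last_cat.
exists x', (l2 ++ s2).
have es2 : x :: l ++ s2 = l1 ++ (x' :: l2 ++ s2) by rewrite -cat_cons exl -catA.
have ll2s : last x' (l2 ++ s2) = last v s2 by rewrite last_cat ll2.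
have l2n : l2 <> [::].
  by move=> e; move: ll2 vX; rewrite e /= => <-; rewrite x'X.
split => //.
- by rewrite ll2s.
- apply/and3P; split.
  + apply/andP; split; last by move: upath; rewrite es2 cat_uniq => /and3P[].
    rewrite cat_path ll2; apply/andP; split.
      by apply: sub_path pl2 => a b ab; rewrite /adj ab !orbT.
    have [_ ea _ _] := rep.
    by apply: sub_path vs2 => a b ab; rewrite -ea /adj ab.
  + by case: (l2) l2n.
  + by move: nback; rewrite es2 pairwise_cat => /and3P[].
- rewrite /proper_wrt all_cat; apply/andP; split; last by case/andP: Xs2.
  by apply/allP => u /(hasPn nl2).
- by case: (l2) l2n pl2 => //= u l3 _ /andP[].
Qed.

End Mpdags.

(** * Buckets *)

Lemma dag_factors_prod (V : finType) (F : fieldType) (D : graph V) (S : {set V})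
    (g : {set V} -> {set V} -> F) :
  \prod_(c <- dag_factors D S) g c.1 c.2 = \prod_(v in S) g [set v] (Pa [set v] D).
Proof. by rewrite big_map big_enum. Qed.

Section Components.
Variable V : finType.
Variables (G : graph V).
Implicit Types (u v w : V) (S C : {set V}).

Definition component u := [set v | connect (und G) u v].

Lemma component_refl u : u \in component u.
Proof. by rewrite inE connect0. Qed.

Lemma component_eq u v : v \in component u -> component v = component u.
Proof.
rewrite inE => uv; apply/setP => w; rewrite !inE.
by rewrite (same_connect (und_connect_sym G) uv).
Qed.

Lemma mem_buckets C : (C \in buckets G [set: V]) = [exists u, C == component u].
Proof.
rewrite inE; apply/andP/existsP => [[/set0Pn[u uC] /maxsetP[/andP[_ cC] mC]]|[u /eqP->]].
  exists u; apply/eqP; rewrite -(mC (component u)) //.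
    rewrite subsetT; apply/forall_inP => v; rewrite inE => uv.
    apply/forall_inP => w; rewrite inE; apply: connect_trans.
    by rewrite und_connect_sym.
  apply/subsetP => v vC; rewrite inE.
  by move/forall_inP/(_ u uC)/forall_inP/(_ v vC): cC.
split; first by apply/set0Pn; exists u; exact: component_refl.
apply/maxsetP; split.
  rewrite subsetT; apply/forall_inP => v; rewrite inE => uv.
  apply/forall_inP => w; rewrite inE; apply: connect_trans.
  by rewrite und_connect_sym.
move=> B /andP[_ cB] sub; apply/eqP; rewrite eqEsubset sub andbT.
apply/subsetP => v vB; rewrite inE.
have uB : u \in B by apply: (subsetP sub); exact: component_refl.
by move/forall_inP/(_ u uB)/forall_inP/(_ v vB): cB.
Qed.

Lemma buckets_disjoint C C' : C \in buckets G [set: V] -> C' \in buckets G [set: V] ->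
  C != C' -> [disjoint C & C'].
Proof.
rewrite !mem_buckets => /existsP[u /eqP->] /existsP[v /eqP->].
apply: contraR; rewrite -setI_eq0 => /set0Pn[w]; rewrite in_setI => /andP[wu wv].
by rewrite -(component_eq wu) (component_eq wv).
Qed.

(** The formula multiplies over the list, so the list is needed up to permutation. *)
Lemma pco_loop_perm S CC L L' : pco_loop G S CC L L' ->
  perm_eq L' ([seq C :&: S | C <- enum CC & C :&: S != set0] ++ L).
Proof.
elim=> {CC L L'} [L|CC C L L' [CCC _] _ IH]; first by rewrite enum_set0.
apply: (perm_trans IH).
have pe : perm_eq (enum CC) (C :: enum (CC :\ C)).
  apply: uniq_perm; rewrite ?enum_uniq //= ?enum_uniq ?mem_enum ?setD11 // => B.
  by rewrite inE !mem_enum in_setD1; case: eqVneq => // ->.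
have := perm_map (fun C => C :&: S) (perm_filter (fun C => C :&: S != set0) pe).
rewrite -(perm_cat2r L) => h; rewrite perm_sym (perm_trans h) //=.
case: ifP => _ //=; rewrite perm_sym.
exact: permEl (perm_catCA _ [:: C :&: S] L).
Qed.

End Components.

(** * Parents and ancestors across undirected components *)

Section MpdagFacts.
Variable V : finType.
Variables (G D : graph V) (X Y : {set V}).
Hypotheses (mpG : mpdag G) (rep : represented G D).
Hypothesis dXY : [disjoint X & Y].
Hypothesis no_path : ~ (exists (x : V) (p : seq V),
       [/\ x \in X, last x p \in Y, possibly_causal G x p, proper_wrt X p
         & starts_undirected G x p]).
Implicit Types (x y u v w : V) (S : {set V}).
Local Notation Z := (avoiding_ancestors D X Y).
Local Notation A := (An Y (induced_subgraph G (~: X))).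

Let dD : dag D. Proof. by case: rep. Qed.

Lemma mem_An v : (v \in A) = [exists y in Y, connect (induced_dir G (~: X)) v y].
Proof.
rewrite !inE; apply/orP/exists_inP => [[vY|/asboolP[p [/andP[pp _] lY]]]|[y yY]].
- by exists v => //; exact: connect0.
- by exists (last v p) => //; apply/connectP; exists p.
move=> /connectP[p pp ey]; right; apply/asboolP.
case/shortenP: pp ey => q qq uq _ ey; exists q; split; last by rewrite -ey.
by rewrite /causal_path uq andbT.
Qed.

Lemma Y_sub_A : Y \subset A. Proof. exact: subsetUl. Qed.

Lemma A_sub_Z : A \subset Z.
Proof.
apply/subsetP => v; rewrite mem_An inE => /exists_inP[y yY vy].
apply/exists_inP; exists y => //; apply: connect_sub vy => a b /and3P[aX bX ab].
by rewrite connect1 // /induced_dir aX bX (dirG_D rep).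
Qed.

Lemma Z_notin_X v : v \in Z -> v \notin X.
Proof. by case/(avoiding_path dXY) => p [_ _ _ /andP[]]. Qed.

Lemma Z_closed u v : v \in Z -> dir D u v -> u \notin X -> u \in Z.
Proof.
move=> vZ uv uX; have vX := Z_notin_X vZ; move: vZ; rewrite !inE.
move=> /exists_inP[y yY vy]; apply/exists_inP; exists y => //.
by apply: connect_trans vy; rewrite connect1 // /induced_dir !inE uX vX.
Qed.

Lemma A_closed u v : v \in A -> dir G u v -> u \notin X -> u \in A.
Proof.
move=> vA uv uX; have vX := Z_notin_X (subsetP A_sub_Z _ vA); move: vA.
rewrite !mem_An => /exists_inP[y yY vy]; apply/exists_inP; exists y => //.
by apply: connect_trans vy; rewrite connect1 // /induced_dir !inE uX vX.
Qed.

Lemma mem_Pa_component u w v : v \in component G w ->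
  (u \in Pa (component G w) G) = (u \notin component G w) && dir G u v.
Proof.
move=> vw; rewrite inE; apply: andb_id2l => uw.
apply/exists_inP/idP => [[s sw us]|uv]; last by exists v.
apply: (dir_component mpG us).
  by move: sw vw; rewrite !inE => sw; apply: connect_trans; rewrite und_connect_sym.
apply: contra uw => h; move: sw; rewrite !inE => sw.
by apply: connect_trans sw _; rewrite und_connect_sym.
Qed.

Lemma Pa_component_A w v : v \in component G w -> v \in A ->
  Pa (component G w) G \subset A :|: X.
Proof.
move=> vw vA; apply/subsetP => u; rewrite (mem_Pa_component _ vw) => /andP[_ uv].
by rewrite in_setU orbC; have [//|uX] := boolP (u \in X); exact: A_closed uv uX.
Qed.

(** Consider the edge by which a path to [Y] leaves the component. It is directed in [G], since
    undirected edges stay inside, so its tail is a parent of the whole next component. By induction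
    that component has a node in [A], and then the tail is in [A] too. *)
Lemma component_Z_A w z : z \in component G w -> z \in Z ->
  component G w :&: A != set0.
Proof.
move=> zw; rewrite inE => /exists_inP[y yY /connectP[p pp ey]].
elim: p z w zw pp ey => [|u p IH] z w zw /=.
  move=> _ ey; apply/set0Pn; exists z; rewrite in_setI zw /=.
  by apply: (subsetP Y_sub_A); rewrite -ey.
move=> /andP[/and3P[zX uX zu] pp] ey.
have [uw|uw] := boolP (u \in component G w); first exact: IH uw pp ey.
have /set0Pn[a] := IH u u (component_refl _ _) pp ey; rewrite in_setI => /andP[au aA].
apply/set0Pn; exists z; rewrite in_setI zw /=.
suff zP : z \in Pa (component G u) G.
  have := subsetP (Pa_component_A au aA) _ zP; rewrite in_setU => /orP[//|].
  by move: zX; rewrite inE => /negbTE->.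
have nzu : z \notin component G u.
  apply: contra uw => zu'; by rewrite -(component_eq zw) (component_eq zu') component_refl.
rewrite (mem_Pa_component _ (component_refl _ _)) nzu /=.
have [//|uzu] := dirD_G rep zu.
by rewrite inE connect1 // und_sym in nzu.
Qed.

Lemma PaD_component w v : v \in component G w ->
  Pa [set v] D = Pa (component G w) G :|: (Pa [set v] D :&: component G w).
Proof.
move=> vw; apply/setP => u; rewrite in_setU in_setI mem_Pa1 (mem_Pa_component _ vw).
have [uw|uw] := boolP (u \in component G w); first by rewrite andbT.
rewrite andbF orbF /=; apply/idP/idP => [uv|]; last exact: dirG_D.
have [//|ue] := dirD_G rep uv; case/negP: uw; move: vw; rewrite !inE => vw.
by apply: connect_trans vw _; rewrite connect1 // und_sym.
Qed.

Lemma PaD_component_Z w v : v \in component G w -> v \in Z ->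
  Pa [set v] D :&: component G w \subset Z.
Proof.
move=> vw vZ; apply/subsetP => u; rewrite in_setI mem_Pa1 => /andP[uv uw].
apply: (Z_closed vZ uv); apply/negP => uX.
apply: (no_edge_within_component mpG rep dXY no_path uX vZ uv).
by move: uw; rewrite -(component_eq vw) inE und_connect_sym.
Qed.

(** A component may contain directed edges. One of them that ends in [A] starts in [A] or in [X]: in
    the first case its tail belongs to the bucket and is no parent of it, and the second case is
    excluded by [no_edge_within_component]. *)
Lemma Pa_bucket w : component G w :&: A != set0 ->
  Pa (component G w :&: A) G = Pa (component G w) G.
Proof.
case/set0Pn => a; rewrite in_setI => /andP[aw aA].
apply/setP => u; rewrite (mem_Pa_component _ aw) inE in_setI.
have [uw|uw] /= := boolP (u \in component G w); last first.
  apply/exists_inP/idP => [[s]|ua]; last by exists a; rewrite // in_setI aw.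
  rewrite in_setI => /andP[sw _] us.
  have : u \in Pa (component G w) G by rewrite (mem_Pa_component _ sw) uw.
  by rewrite (mem_Pa_component _ aw) => /andP[].
apply/negbTE; rewrite negb_and negbK.
have [//|uA] := boolP (u \in A); apply/exists_inP => -[s].
rewrite in_setI => /andP[sw sA] us; case/negP: uA; apply: (A_closed sA us).
apply/negP => uX.
apply: (no_edge_within_component mpG rep dXY no_path uX (subsetP A_sub_Z _ sA)).
  exact: (dirG_D rep).
by move: sw; rewrite -(component_eq uw) inE.
Qed.

Definition dag_ancestors S : {set V} := [set u | [exists s in S, connect (dir D) u s]].

Lemma dag_ancestors_closed S u v : v \in dag_ancestors S -> dir D u v ->
  u \in dag_ancestors S.
Proof.
rewrite !inE => /exists_inP[s sS vs] uv; apply/exists_inP; exists s => //.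
exact: connect_trans (connect1 uv) vs.
Qed.

Lemma sub_dag_ancestors S : S \subset dag_ancestors S.
Proof.
by apply/subsetP => s sS; rewrite inE; apply/exists_inP; exists s.
Qed.

(** A parent of the component points to all of it, so a directed path from the component to such a
    parent would close a cycle. *)
Lemma dag_ancestors_Pa_component w :
  [disjoint dag_ancestors (Pa (component G w) G) & component G w].
Proof.
rewrite disjoint_subset; apply/subsetP => c; rewrite !inE.
move=> /exists_inP[s sP /connectP[p pp es]]; apply/negP => wc.
have cw : c \in component G w by rewrite inE.
elim: p c pp cw es {wc} => [|u p IH] c /=.
  by move=> _ cw es; move: sP; rewrite (mem_Pa_component _ cw) es cw.
move=> /andP[cu pp] cw es.
have [uw|uw] := boolP (u \in component G w); first exact: IH uw es.
have : dir D s c.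
  by apply: (dirG_D rep); move: sP; rewrite (mem_Pa_component _ cw) => /andP[].
rewrite (dag_acyclic dD) //; apply: connect_trans (connect1 cu) _.
by apply/connectP; exists p.
Qed.

End MpdagFacts.

From mathcomp Require Import all_classical all_reals all_analysis.
From mathcomp Require Import measurable_realfun.
Local Open Scope ring_scope.

(** * Iterated integrals *)

Section Integrals.
Variables (R : realType) (V : finType) (d : V -> measure_display).
Variable T : forall v, measurableType (d v).
Variable mu : forall v, {sigma_finite_measure set (T v) -> \bar R}.
Local Open Scope ereal_scope.
Local Notation val := (values T).
Implicit Types (w : val) (S K : {set V}) (F H : val -> \bar R) (s : seq V).

Definition mnn F := measurable_fun [set: val]%classic F /\ forall w, 0 <= F w.

Definition upd w v (x : T v) : val := @dfwith V T w v x.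

Lemma upd_in w v (x : T v) : upd w x v = x.
Proof. exact: dfwithin. Qed.

Lemma upd_out w v (x : T v) u : v != u -> upd w x u = w u.
Proof. exact: dfwithout. Qed.

Lemma upd_comm w u v (x : T u) (y : T v) : u != v ->
  upd (upd w x) y = upd (upd w y) x.
Proof.
move=> uv; apply: functional_extensionality_dep => z.
have [<-|vz] := eqVneq v z.
  by rewrite upd_in upd_out// upd_in.
rewrite upd_out//; have [uz|uz] := eqVneq u z.
  by subst z; rewrite !upd_in.
by rewrite !upd_out.
Qed.

Lemma measurable_coord v : measurable_fun [set: val]%classic (fun w : val => w v).
Proof.
move=> _ A mA; rewrite setTI; apply: sub_sigma_algebra.
by exists v, A.
Qed.

Lemma measurable_into_values d' (U : measurableType d') (g : U -> val) :
  (forall v, measurable_fun [set: U]%classic (fun u => g u v)) ->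
  measurable_fun [set: U]%classic g.
Proof.
move=> mg.
apply: (@measurability _ _ U val [set: U]%classic g (coordinate_events (T:=T))) => //.
move=> _ [_ [v [A [mA ->]]] <-]; have := mg v measurableT A mA.
by [].
Qed.

Lemma measurable_upd v :
  measurable_fun [set: val * T v]%classic (fun p : val * T v => upd p.1 p.2).
Proof.
apply: measurable_into_values => u; have [uv|uv] := eqVneq v u.
  subst u; rewrite (_ : (fun _ => _) = snd); first exact: measurable_snd.
  by apply: funext => p; rewrite upd_in.
rewrite (_ : (fun _ => _) = (fun w : val => w u) \o fst).
  by apply: measurableT_comp; [exact: measurable_coord|exact: measurable_fst].
by apply: funext => p; rewrite upd_out.
Qed.

Lemma measurable_upd1 w v : measurable_fun [set: T v]%classic (fun x : T v => upd w x).
Proof.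
apply: measurable_into_values => u; have [uv|uv] := eqVneq v u.
  subst u; rewrite (_ : (fun _ => _) = id); first exact: measurable_id.
  by apply: funext => p; rewrite upd_in.
rewrite (_ : (fun _ => _) = cst (w u)); first exact: measurable_cst.
by apply: funext => p; rewrite upd_out.
Qed.

Lemma mnn_subst d' (U : measurableType d') F (g : U -> val) : mnn F ->
  measurable_fun [set: U]%classic g -> measurable_fun [set: U]%classic (fun u => F (g u)).
Proof. by case=> mF _ mg; exact: measurableT_comp mF mg. Qed.

Lemma mnn_upd F w v : mnn F -> measurable_fun [set: T v]%classic (fun x : T v => F (upd w x)).
Proof. by move=> mF; exact: mnn_subst mF (measurable_upd1 w (v:=v)). Qed.

Definition int1 v F w := \int[mu v]_x F (upd w x).

Lemma mnn_int1 v F : mnn F -> mnn (int1 v F).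
Proof.
move=> mF; have [_ F0] := mF; split; last by move=> w; apply: integral_ge0 => x _.
have := @measurable_fun_fubini_tonelli_F _ _ val (T v) R (mu v)
  (fun p => F (upd p.1 p.2)).
by apply => //; apply: (mnn_subst mF); exact: measurable_upd.
Qed.

Lemma int1_comm u v F w : mnn F -> u != v ->
  int1 u (int1 v F) w = int1 v (int1 u F) w.
Proof.
move=> mF uv; have [_ F0] := mF; rewrite /int1.
rewrite (@fubini_tonelli _ _ (T u) (T v) R (mu u) (mu v)
  (fun p => F (upd (upd w p.1) p.2))) //=.
- by apply: eq_integral => y _; apply: eq_integral => x _; rewrite upd_comm.
- apply: (mnn_subst mF); apply: measurable_into_values => z.
  have [vz|vz] := eqVneq v z.
    subst z; rewrite (_ : (fun _ => _) = snd); first exact: measurable_snd.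
    by apply: funext => p; rewrite upd_in.
  have [uz|uz] := eqVneq u z.
    subst z; rewrite (_ : (fun _ => _) = fst); first exact: measurable_fst.
    by apply: funext => p; rewrite upd_out // upd_in.
  rewrite (_ : (fun _ => _) = cst (w z)); first exact: measurable_cst.
  by apply: funext => p; rewrite !upd_out.
Qed.

Local Notation II := (iterated_integral mu).

Lemma mnn_iterated s F : mnn F -> mnn (II s F).
Proof. by move=> mF; elim: s => [|v s IH] //=; exact: mnn_int1. Qed.

Lemma iterated_cat s s' F : II (s ++ s') F = II s (II s' F).
Proof.
elim: s => [|v s IH] //=; apply: funext => w.
by apply: eq_integral => x _; rewrite IH.
Qed.

Lemma iterated_rot v s F w : mnn F -> v \notin s ->
  II (v :: s) F w = II s (int1 v F) w.
Proof.
move=> mF; elim: s w => [|u s IH] w //=.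
rewrite inE negb_or => /andP[vu vs].
rewrite -[LHS]/(int1 v (int1 u (II s F)) w) int1_comm //; last exact: mnn_iterated.
by apply: eq_integral => x _; exact: IH.
Qed.

Lemma iterated_cat_cons v s s' F w : mnn F -> v \notin s ->
  II (s ++ v :: s') F w = II (v :: s ++ s') F w.
Proof.
move=> mF vs; rewrite iterated_cat -cat_cons iterated_cat.
by rewrite iterated_rot //; exact: mnn_iterated.
Qed.

Lemma perm_iterated s s' F : mnn F -> uniq s -> perm_eq s s' ->
  II s F = II s' F.
Proof.
move=> mF us ss'.
elim: s s' us ss' => [|v s IH] s' /=.
  by move=> _; rewrite perm_sym => /perm_nilP ->.
move=> /andP[vs us] ps; have vs' : v \in s' by rewrite -(perm_mem ps) mem_head.
have us' : uniq s' by rewrite -(perm_uniq ps) /= vs us.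
case/splitPr: vs' ps us' => p1 p2 ps us'; apply: funext => w.
rewrite iterated_cat_cons //=.
  rewrite (IH (p1 ++ p2)) // -(perm_cons v) (perm_trans ps) //.
  exact: permEl (perm_catCA p1 [:: v] p2).
by move: us'; rewrite cat_uniq /= => /and4P[_]; rewrite negb_or => /andP[].
Qed.

Local Notation I := (integral_over mu).

Lemma mnn_integral S F : mnn F -> mnn (I S F).
Proof. exact: mnn_iterated. Qed.

Lemma integral_over_seq S s F w : mnn F -> uniq s -> s =i S ->
  I S F w = II s F w.
Proof.
move=> mF us sS; rewrite /integral_over (@perm_iterated (enum S) s) //.
  exact: enum_uniq.
by apply: uniq_perm => //; [exact: enum_uniq|move=> v; rewrite mem_enum sS].
Qed.

Lemma integral_overU S S' F w : mnn F -> [disjoint S & S'] ->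
  I (S :|: S') F w = I S (I S' F) w.
Proof.
move=> mF dis; rewrite (@integral_over_seq _ (enum S ++ enum S')) //.
- by rewrite iterated_cat.
- rewrite cat_uniq !enum_uniq andbT /=; apply/hasPn => v.
  by rewrite !mem_enum => /(disjointFl dis) ->.
- by move=> v; rewrite mem_cat !mem_enum inE.
Qed.

Lemma integral_overD S S' F w : mnn F -> S' \subset S ->
  I S F w = I (S :\: S') (I S' F) w.
Proof.
move=> mF sub; rewrite -integral_overU //.
  by rewrite finset.setUC -{1}(finset.setIidPr sub) finset.setID.
by rewrite disjoint_subset; apply/fintype.subsetP => v; rewrite !inE => /andP[].
Qed.

Lemma integral_over0 F w : I finset.set0 F w = F w.
Proof. by rewrite /integral_over enum_set0. Qed.

End Integrals.

(** * Order, linearity and vanishing of iterated integrals *)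

Section Null.
Variables (R : realType) (V : finType) (d : V -> measure_display).
Variable T : forall v, measurableType (d v).
Variable mu : forall v, {sigma_finite_measure set (T v) -> \bar R}.
Local Open Scope ereal_scope.
Local Notation val := (values T).
Implicit Types (w : val) (S K : {set V}) (F H : val -> \bar R) (s : seq V).
Implicit Types (N : set val) (P Q : val -> Prop).
Local Notation II := (iterated_integral mu).
Local Notation I := (integral_over mu).

Definition indicator N : val -> \bar R := fun w => (\1_N w)%:E.

Lemma mnn_ind N : measurable N -> mnn (indicator N).
Proof.
move=> mN; split; last by move=> w; rewrite lee_fin indicE.
by apply/measurable_EFinP; exact: measurable_indic.
Qed.

Lemma ind1 N w : N w -> indicator N w = 1.
Proof. by move=> Nw; rewrite /indicator indicE mem_set. Qed.

Lemma ind0 N w : ~ N w -> indicator N w = 0.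
Proof. by move=> Nw; rewrite /indicator indicE memNset. Qed.

Lemma ind_eq0 N w : indicator N w = 0 -> ~ N w.
Proof. by move=> + Nw; rewrite ind1 // => /eqP; rewrite onee_eq0. Qed.

Lemma mnn_add F H : mnn F -> mnn H -> mnn (fun w => F w + H w).
Proof.
move=> [mF F0] [mH H0]; split; last by move=> w; exact: adde_ge0.
exact: emeasurable_funD.
Qed.

Lemma mnn_mul F H : mnn F -> mnn H -> mnn (fun w => F w * H w).
Proof.
move=> [mF F0] [mH H0]; split; last by move=> w; exact: mule_ge0.
exact: emeasurable_funM.
Qed.

Lemma mnn_cst (k : \bar R) : 0 <= k -> mnn (fun _ : val => k).
Proof. by split=> //; exact: measurable_cst. Qed.

(** Agreement outside a list, the form that suits induction on the list of integrated
    coordinates. *)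
Definition off s w w' := forall v, v \notin s -> w' v = w v.

Lemma off_upd s v w w' (x : T v) : off s (upd w x) w' -> off (v :: s) w w'.
Proof.
by move=> o u; rewrite inE negb_or => /andP[uv us]; rewrite o// upd_out// eq_sym.
Qed.

Lemma off_enum S w w' : off (enum S) w w' <-> agree_on (~: S) w w'.
Proof.
by split=> o v; [rewrite inE => vS|rewrite mem_enum => vS];
  apply: o; rewrite ?mem_enum// inE.
Qed.

Lemma agree_sub S K w w' : K \subset S -> agree_on S w w' -> agree_on K w w'.
Proof. by move=> /fintype.subsetP sub a v vK; apply: a; exact: sub. Qed.

Lemma agree_sym S w w' : agree_on S w w' -> agree_on S w' w.
Proof. by move=> a v vS; rewrite a. Qed.

Lemma agree_trans S w w' w'' :
  agree_on S w w' -> agree_on S w' w'' -> agree_on S w w''.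
Proof. by move=> a b v vS; rewrite b// a. Qed.

Lemma eq_iterated s F H w : (forall w', off s w w' -> F w' = H w') ->
  II s F w = II s H w.
Proof.
elim: s w => [|v s IH] w e /=; first exact: e.
by apply: eq_integral => x _; apply: IH => w' o; exact/e/(off_upd o).
Qed.

Lemma eq_integral_over S F H w :
  (forall w', agree_on (~: S) w w' -> F w' = H w') -> I S F w = I S H w.
Proof. by move=> e; apply: eq_iterated => w' /off_enum; exact: e. Qed.

Lemma le_integral_over S F H w : mnn F -> mnn H ->
  (forall w', agree_on (~: S) w w' -> F w' <= H w') -> I S F w <= I S H w.
Proof.
move=> mF mH; rewrite /integral_over => e.
have {e} : forall w', off (enum S) w w' -> F w' <= H w'.
  by move=> w' /off_enum; exact: e.
elim: (enum S) w => [|v s IH] w e /=; first exact: e.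
apply: ge0_le_integral => //.
- by move=> x _; have [_] := mnn_iterated mu s mF; apply.
- exact: (mnn_upd w (mnn_iterated mu s mF)).
- exact: (mnn_upd w (mnn_iterated mu s mH)).
- by move=> x _; apply: IH => w' o; exact/e/(off_upd o).
Qed.

Lemma integral_overDr S F H w : mnn F -> mnn H ->
  I S (fun w => F w + H w) w = I S F w + I S H w.
Proof.
move=> mF mH; rewrite /integral_over.
elim: (enum S) w => [|v s IH] w //=; under eq_integral do rewrite IH.
rewrite ge0_integralD //.
- by move=> x _; have [_] := mnn_iterated mu s mF; apply.
- exact: (mnn_upd w (mnn_iterated mu s mF)).
- by move=> x _; have [_] := mnn_iterated mu s mH; apply.
- exact: (mnn_upd w (mnn_iterated mu s mH)).
Qed.

Lemma integral_over_cstM S (k : \bar R) F w : mnn F -> 0 <= k ->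
  I S (fun w => k * F w) w = k * I S F w.
Proof.
move=> mF k0; rewrite /integral_over.
elim: (enum S) w => [|v s IH] w //=; under eq_integral do rewrite IH.
rewrite ge0_integralZl //.
- exact: (mnn_upd w (mnn_iterated mu s mF)).
- by move=> x _; have [_] := mnn_iterated mu s mF; apply.
Qed.

Definition depends_on K F := forall w w', agree_on K w w' -> F w' = F w.

Lemma dep_sub K K' F : K \subset K' -> depends_on K F -> depends_on K' F.
Proof. by move=> sub dF w w' a; apply: dF; exact: agree_sub a. Qed.

Lemma dep_setT F : depends_on [set: V] F.
Proof.
move=> w w' a; congr F; apply: functional_extensionality_dep => v.
by apply: a; rewrite inE.
Qed.

Lemma integral_overM S K c F w : mnn F -> (forall w, 0 <= c w) -> depends_on K c ->
  [disjoint K & S] -> I S (fun w => c w * F w) w = c w * I S F w.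
Proof.
move=> mF c0 dc KS; rewrite -integral_over_cstM //; apply: eq_integral_over => w' a.
rewrite (dc w) //; apply: agree_sub a; apply/fintype.subsetP => v vK.
by rewrite inE (disjointFr KS vK).
Qed.

Lemma dep_integral S K F : depends_on K F -> depends_on (K :\: S) (I S F).
Proof.
move=> dF w w' a; rewrite /integral_over.
have {a} : forall v, v \in K -> v \notin enum S -> w' v = w v.
  by move=> v vK; rewrite mem_enum => vS; apply: a; rewrite inE vS.
elim: (enum S) w w' => [|v s IH] w w' a /=.
  by apply: dF => v vK; exact: a.
apply: eq_integral => x _; apply: IH => u uK us.
have [<-|vu] := eqVneq v u; first by rewrite !dfwithin.
by rewrite !dfwithout //; apply: a => //; rewrite inE negb_or us eq_sym vu.
Qed.

(** Coordinate by coordinate, a vanishing integral means that the inner one vanishes almost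
    everywhere. Null sets are thereby handled through iterated integrals alone, and [H] need not be
    bounded by a multiple of [F]. *)
Lemma integral_over_null S F H w : mnn F -> mnn H -> I S F w = 0 ->
  (forall w', agree_on (~: S) w w' -> F w' = 0 -> H w' = 0) -> I S H w = 0.
Proof.
move=> mF mH; rewrite /integral_over => F0 e.
have {e} : forall w', off (enum S) w w' -> F w' = 0 -> H w' = 0.
  by move=> w' /off_enum; exact: e.
elim: (enum S) w F0 => [|v s IH] w /= F0 e; first exact: e.
have mFs := mnn_iterated mu s mF; have mHs := mnn_iterated mu s mH.
have : ae_eq (mu v) [set: T v]%classic (fun x => II s F (upd w x)) (cst 0).
  apply/ae_eq_integral_abs => //; first exact: mnn_upd mFs.
  by under eq_integral do rewrite gee0_abs ?mFs.2//.
move=> ae0.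
rewrite (@ge0_ae_eq_integral _ _ _ (mu v) _ _ (cst 0)) //.
- by rewrite integral_cst// mul0e.
- exact: mnn_upd mHs.
- by move=> x _; exact: mHs.2.
- apply: filterS ae0 => x /= + _ => /(_ Logic.I) x0; apply: IH => // w' o.
  exact/e/(off_upd o).
Qed.

Lemma integral_over_zero S w : I S (fun=> 0) w = 0.
Proof.
rewrite /integral_over; elim: (enum S) w => [|v s IH] w //=.
by under eq_integral do rewrite IH; rewrite integral0.
Qed.

End Null.

(** * Null sets *)

Section AlmostAll.
Variables (R : realType) (V : finType) (d : V -> measure_display).
Variable T : forall v, measurableType (d v).
Variable mu : forall v, {sigma_finite_measure set (T v) -> \bar R}.
Local Open Scope ereal_scope.
Local Notation val := (values T).
Implicit Types (w : val) (S K : {set V}) (F H : val -> \bar R) (s : seq V).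
Implicit Types (N : set val) (P Q : val -> Prop).
Local Notation I := (integral_over mu).
Local Notation aa := (almost_all mu).

Lemma aaP S w P : aa S w P <-> exists N : set val, [/\ measurable N,
  I S (indicator R N) w = 0 & forall w', agree_on (~: S) w w' -> ~ P w' -> N w'].
Proof. by []. Qed.

Lemma aa_mono S w P Q : aa S w P ->
  (forall w', agree_on (~: S) w w' -> P w' -> Q w') -> aa S w Q.
Proof.
move=> [N [mN N0 h]] e; exists N; split=> // w' a nQ; apply: h => // pw.
by apply: nQ; exact: e.
Qed.

Lemma aa_true S w P : (forall w', agree_on (~: S) w w' -> P w') -> aa S w P.
Proof.
move=> e; exists set0; split => //; last by move=> w' /e.
rewrite (_ : (fun _ => _) = fun=> 0) ?integral_over_zero//.
by apply: funext => w'; rewrite indicE in_set0.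
Qed.

Lemma aa_and S w P Q : aa S w P -> aa S w Q -> aa S w (fun w' => P w' /\ Q w').
Proof.
move=> [N [mN N0 h]] [N' [mN' N0' h']]; exists (N `|` N')%classic; split.
- exact: measurableU.
- have mI := mnn_ind R mN; have mI' := mnn_ind R mN'.
  apply: (@integral_over_null _ _ _ _ mu S (fun w => indicator R N w + indicator R N' w)).
  + exact: mnn_add.
  + by apply: mnn_ind; exact: measurableU.
  + by rewrite integral_overDr // -[RHS]adde0; congr (_ + _).
  + move=> w' _ /eqP; rewrite padde_eq0; [|exact: mI.2|exact: mI'.2].
    by move=> /andP[/eqP/ind_eq0 n /eqP/ind_eq0 n']; rewrite -/(indicator _ _ _) ind0//; case.
- move=> w' a nPQ; have [Pw|nP] := pselect (P w'); last by left; exact: h.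
  by right; apply: h' => // Qw; exact: nPQ.
Qed.

Lemma aa_all (J : finType) S w (P : J -> val -> Prop) :
  (forall j, aa S w (P j)) -> aa S w (fun w' => forall j, P j w').
Proof.
move=> h; suff : aa S w (fun w' => forall j, j \in enum J -> P j w').
  by move=> /aa_mono; apply => w' _ e j; apply: e; rewrite mem_enum.
elim: (enum J) => [|j l IH]; first by apply: aa_true.
apply: (aa_mono (aa_and (h j) IH)) => w' _ [pj pl] k.
by rewrite inE => /predU1P[->//|]; exact: pl.
Qed.

Lemma aa_measurable S w N : measurable N ->
  aa S w (fun w' => ~ N w') <-> I S (indicator R N) w = 0.
Proof.
move=> mN; split; last first.
  by move=> N0; exists N; split => // w' _ /contrapT.
move=> /aaP[N' [mN' N0' h]].
apply: (@integral_over_null _ _ _ _ mu S (indicator R N')); try exact: mnn_ind.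
  exact: N0'.
move=> w' a /ind_eq0 nN'; rewrite ind0 // => Nw; apply: nN'; exact: h.
Qed.

Lemma measurable_eq F H : mnn F -> mnn H ->
  measurable [set w : val | F w = H w]%classic.
Proof.
move=> [mF _] [mH _]; rewrite -[X in measurable X]setTI; exact: measurable_eqe.
Qed.

Lemma measurable_ne F H : mnn F -> mnn H ->
  measurable [set w : val | F w <> H w]%classic.
Proof. by move=> mF mH; apply: measurableC; exact: measurable_eq. Qed.

Lemma measurable_pred_aa S w P : measurable [set w | ~ P w]%classic ->
  aa S w P <-> I S (indicator R [set w | ~ P w]%classic) w = 0.
Proof.
move=> mP; rewrite -aa_measurable //; split=> /aa_mono; apply => w' _ /=.
  by move=> Pw; apply.
by move=> /contrapT.
Qed.

Lemma aa_zero S w H : mnn H -> I S H w = 0 -> aa S w (fun w' => H w' = 0).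
Proof.
move=> mH H0; have m0 := mnn_cst T (lexx (0 : \bar R)).
apply/measurable_pred_aa; first exact: (measurable_ne mH m0).
apply: (integral_over_null mH _ H0); first exact: (mnn_ind _ (measurable_ne mH m0)).
by move=> w' _ Hw; rewrite ind0 //=; apply.
Qed.

Lemma aa_le_integral S w F H : mnn F -> mnn H ->
  aa S w (fun w' => F w' <= H w') -> I S F w <= I S H w.
Proof.
move=> mF mH [N [mN N0 h]]; have mi := mnn_ind R mN; have mic := mnn_ind R (measurableC mN).
have mFn : mnn (fun w => indicator R N w * F w) by exact: mnn_mul.
have mFc : mnn (fun w => indicator R (~` N)%classic w * F w) by exact: mnn_mul.
rewrite (_ : I S F w = I S (fun w => indicator R (~` N)%classic w * F w) w); last first.
  transitivity (I S (fun w => indicator R (~` N)%classic w * F w + indicator R N w * F w) w).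
    apply: eq_integral_over => w' _; have [Nw|nN] := pselect (N w').
      by rewrite ind0 ?ind1 ?mul0e ?mul1e ?add0e//; apply.
    by rewrite ind1// ind0// mul0e mul1e adde0.
  rewrite integral_overDr // [X in _ + X](_ : _ = 0) ?adde0 //.
  apply: (integral_over_null mi mFn) => //.
  by move=> w' _ ->; rewrite mul0e.
apply: le_integral_over => // w' a; have [Nw|nN] := pselect (N w').
  by rewrite ind0 ?mul0e ?mH.2//; apply.
by rewrite ind1// mul1e; apply: contrapT => nle; apply: nN; exact: h.
Qed.

Lemma aa_eq_integral S w F H : mnn F -> mnn H ->
  aa S w (fun w' => F w' = H w') -> I S F w = I S H w.
Proof.
move=> mF mH e; apply/eqP; rewrite eq_le; apply/andP; split.
  by apply: aa_le_integral => //; apply: (aa_mono e) => w' _ ->.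
by apply: aa_le_integral => //; apply: (aa_mono e) => w' _ ->.
Qed.

Lemma aa_fubini S S' w P : S' \subset S -> aa S w P ->
  aa S w (fun w' => aa S' w' P).
Proof.
move=> sub [N [mN N0 h]]; have mi := mnn_ind R mN.
have mI := mnn_integral mu S' mi.
have m0 := mnn_cst T (lexx (0 : \bar R)).
have mB := measurable_ne mI m0.
exists [set w | I S' (indicator R N) w <> 0]%classic; split => //.
(* The coordinates of [S :\: S'] are integrated first. Over them the exceptional set is already
   null, because integrating the function that defines it gives the integral of the indicator of [N]
   over [S], which is 0. *)
- pose S1 := S :\: S'; have sub1 : S1 \subset S by exact: finset.subsetDl.
  have mB' := mnn_ind R mB.
  rewrite (integral_overD mu w mB' sub1) -[RHS](integral_over_zero mu (S :\: S1) w).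
  apply: eq_integral_over => w' a.
  apply: (integral_over_null mI mB').
    rewrite -integral_overD // -N0; apply: (@dep_integral _ _ _ _ mu S [set: V]) => [|v].
      exact: dep_setT.
    rewrite !inE andbT => vS; apply: a; rewrite !inE (negbTE vS) andbF //.
  by move=> w'' _ e; rewrite ind0.
- move=> w' a nP; apply: contrapT => /contrapT h0; apply: nP; exists N; split=> //.
  move=> w'' a' nP; apply: h => //; apply: agree_trans a _.
  by apply: agree_sub a'; rewrite finset.setCS.
Qed.

Lemma aa_sub S S' w N : measurable N -> S' \subset S ->
  (forall w', agree_on (~: S) w w' -> aa S' w' (fun w'' => ~ N w'')) ->
  aa S w (fun w' => ~ N w').
Proof.
move=> mN sub h; apply/aa_measurable => //.
rewrite (integral_overD mu w (mnn_ind R mN) sub).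
rewrite -[RHS](integral_over_zero mu (S :\: S') w); apply: eq_integral_over => w' a.
apply/aa_measurable => //; apply: h; apply: agree_sub a.
by rewrite finset.setCS finset.subsetDl.
Qed.

Lemma aa_finite S w F : mnn F -> I S F w < +oo -> aa S w (fun w' => F w' < +oo).
Proof.
move=> mF Foo; have my := mnn_cst T (leey (0 : \bar R)).
have mE := measurable_eq mF my.
suff : I S (indicator R [set w | F w = +oo]%classic) w = 0.
  move/(proj2 (aa_measurable _ _ mE))/aa_mono; apply => w' _ /= ne.
  by rewrite lt_neqAle leey andbT; apply/eqP.
have mi := mnn_ind R mE.
have h : +oo * I S (indicator R [set w | F w = +oo]%classic) w <= I S F w.
  rewrite -integral_over_cstM //; apply: le_integral_over => // [|w' _].
    exact: mnn_mul my mi.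
  have [e|ne] := pselect (F w' = +oo); first by rewrite e leey.
  by rewrite ind0 // mule0; exact: mF.2.
have i0 := (mnn_integral mu S mi).2 w.
apply: contrapT => /eqP ne; move: h; rewrite gt0_mulye ?lt_neqAle 1?eq_sym ?ne //.
by rewrite leNgt Foo.
Qed.

Lemma aa_exists S w P H : aa S w P -> mnn H -> I S H w <> 0 ->
  exists w', [/\ agree_on (~: S) w w', P w' & H w' <> 0].
Proof.
move=> [N [mN N0 h]] mH H0; apply: contrapT => ne; apply: H0.
apply: (integral_over_null (mnn_ind R mN) mH N0) => w' a /ind_eq0 nN.
apply: contrapT => Hw; apply: ne; exists w'; split => //.
by apply: contrapT => nP; apply: nN; exact: h.
Qed.

(** The integral of the indicator over [S] is a constant. If it were not 0, its vanishing integral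
    over the other coordinates would force every function to integrate to 0 over them, against the
    choice of [H], which will be [f]. *)
Lemma aa_dep S w0 H N : mnn H -> I [set: V] H w0 <> 0 -> measurable N ->
  depends_on S (indicator R N) -> aa [set: V] w0 (fun w => ~ N w) ->
  aa S w0 (fun w => ~ N w).
Proof.
move=> mH H0 mN dN /aa_measurable => /(_ mN) N0; apply/aa_measurable => //.
have mi := mnn_ind R mN; apply: contrapT => c0; apply: H0.
have subT : S \subset [set: V] by exact: finset.subsetT.
rewrite (integral_overD mu _ mH subT).
apply: (integral_over_null (mnn_integral mu S mi) (mnn_integral mu S mH)).
  by rewrite -integral_overD.
move=> w' _ e; case: c0; rewrite -e; apply: (@dep_integral _ _ _ _ mu S _ _ dN) => v.
by rewrite finset.setDv inE.
Qed.

(* The function [H] only shows that no measure [mu v] is zero. *)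
Lemma aa_slices S w0 H N : mnn H -> I [set: V] H w0 <> 0 -> measurable N ->
  aa [set: V] w0 (fun w => aa S w (fun w' => ~ N w')) ->
  aa [set: V] w0 (fun w => ~ N w).
Proof.
move=> mH H0 mN h; have mi := mnn_ind R mN; have mI := mnn_integral mu S mi.
have m0 := mnn_cst T (lexx (0 : \bar R)); have mB := measurable_ne mI m0.
apply/aa_measurable => //; rewrite (integral_overD mu w0 mi (finset.subsetT S)).
rewrite -[RHS](integral_over_zero mu ([set: V] :\: S) w0).
apply: aa_eq_integral => //.
have dB : depends_on ([set: V] :\: S) (indicator R [set w | I S (indicator R N) w <> 0]%classic).
  move=> w1 w2 a; have e := @dep_integral _ _ _ _ mu S _ _ (dep_setT (indicator R N)) _ _ a.
  have [n|n] := pselect (I S (indicator R N) w1 <> 0).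
    by rewrite !ind1 //= e.
  by rewrite !ind0 //= e.
have hB : aa [set: V] w0 (fun w => ~ [set w | I S (indicator R N) w <> 0]%classic w).
  by apply: (aa_mono h) => w _ /(aa_measurable _ _ mN) /= e; apply.
by apply: (aa_mono (aa_dep mH H0 mB dB hB)) => w _ /= /contrapT.
Qed.

Lemma mem_bigcup_seq (J : Type) (l : seq J) (s : J -> {set V}) v :
  (v \in \bigcup_(j <- l) s j) = has (fun j => v \in s j) l.
Proof.
by elim: l => [|j l IH]; rewrite ?big_nil ?big_cons inE //= IH.
Qed.

(** Here [s j] holds the coordinates integrated in factor [j], and [k j] those it depends on.
    Factors may share parameters, but not variables of integration. *)
Lemma integral_over_prod (J : eqType) (l : seq J) (s k : J -> {set V})
    (F : J -> val -> R) w : uniq l ->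
  (forall j, mnn (fun w => (F j w)%:E)) ->
  {in l, forall j, depends_on (k j) (fun w => (F j w)%:E)} ->
  {in l &, forall i j, i != j -> [disjoint s i & s j]} ->
  {in l &, forall i j, i != j -> [disjoint k i & s j]} ->
  I (\bigcup_(j <- l) s j) (fun w => (\prod_(j <- l) F j w)%R%:E) w =
  \big[mule/1]_(j <- l) I (s j) (fun w => (F j w)%:E) w.
Proof.
move=> ul mF; elim: l w ul => [|i l IH] w /=.
  by move=> _ _ _ _; rewrite big_nil big_nil integral_over0 big_nil.
move=> /andP[il ul] dF dss dks; rewrite !big_cons.
have il' : i \in i :: l by exact: mem_head.
have ll' j : j \in l -> j \in i :: l by rewrite inE orbC => ->.
have {}IH w' := IH w' ul (sub_in1 ll' dF) (sub_in2 ll' dss) (sub_in2 ll' dks).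
have Fge j w' : (0 <= F j w')%R by rewrite -lee_fin; exact: (mF j).2.
have neq j : j \in l -> i != j by move=> jl; apply: contraNneq il => ->.
have dis : [disjoint s i & \bigcup_(j <- l) s j].
  rewrite disjoint_subset; apply/fintype.subsetP => v vi; rewrite inE.
  rewrite mem_bigcup_seq; apply/hasPn => j jl.
  by rewrite (disjointFr (dss _ _ il' (ll' _ jl) (neq j jl)) vi).
have mprod l' : mnn (fun w => (\prod_(j <- l') F j w)%R%:E).
  split; last by move=> w'; rewrite lee_fin prodr_ge0.
  apply/measurable_EFinP; apply: measurable_prod => j _.
  by apply/measurable_EFinP; exact: (mF j).1.
under eq_integral_over do rewrite big_cons EFinM.
rewrite integral_overU //; last exact: mnn_mul (mF i) (mprod l).
rewrite (@eq_integral_over _ _ _ _ _ (s i) _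
  (fun w' => \big[mule/1]_(j <- l) I (s j) (fun w => (F j w)%:E) w' *
    (F i w')%:E)); last first.
  move=> w' _; rewrite (@integral_overM _ _ _ _ mu _ (k i)) //.
  - by rewrite IH muleC.
  - by move=> w''; exact: (mF i).2.
  - exact: dF.
  - rewrite disjoint_subset; apply/fintype.subsetP => v vi; rewrite inE.
    rewrite mem_bigcup_seq; apply/hasPn => j jl.
    by rewrite (disjointFr (dks _ _ il' (ll' _ jl) (neq j jl)) vi).
rewrite (@integral_overM _ _ _ _ mu _ (\bigcup_(j <- l) k j)) //.
- by rewrite muleC.
- move=> w'; apply: (big_ind (fun x => 0 <= x)) => [|x y|j _]; first exact: lee01.
    exact: mule_ge0.
  exact: (mnn_integral mu (s j) (mF j)).2.
- move=> w1 w2 a; apply: eq_big_seq => j jl.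
  apply: (@dep_integral _ _ _ _ mu (s j) _ _ (dF j (ll' _ jl))) => v.
  rewrite inE => /andP[_ vk].
  by apply: a; rewrite mem_bigcup_seq; apply/hasP; exists j.
- rewrite disjoint_subset; apply/fintype.subsetP => v; rewrite mem_bigcup_seq.
  move=> /hasP[j jl vj]; rewrite inE (disjointFr (dks j i (ll' _ jl) il' _) vj) //.
  by rewrite eq_sym neq.
Qed.

End AlmostAll.

(** * Marginal and conditional densities *)

Section Marginals.
Variables (R : realType) (V : finType) (d : V -> measure_display).
Variable T : forall v, measurableType (d v).
Variable mu : forall v, {sigma_finite_measure set (T v) -> \bar R}.
Local Open Scope ereal_scope.
Local Notation val := (values T).
Implicit Types (w : val) (S K A B : {set V}) (D : graph V).
Local Notation I := (integral_over mu).
Local Notation aa := (almost_all mu).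
Variable f : val -> R.
Hypothesis df : density mu f.
Local Notation m := (marginal mu f).

Lemma mnn_density : mnn (EFin \o f).
Proof.
by case: df => mf f0 _; split; [apply/measurable_EFinP|move=> w; rewrite lee_fin].
Qed.

Lemma mnn_marginal A : mnn (m A).
Proof. exact/mnn_integral/mnn_density. Qed.

Lemma marginal_ge0 A w : 0 <= m A w.
Proof. exact: (mnn_marginal A).2. Qed.

Lemma dep_marginal A : depends_on A (m A).
Proof.
by have := @dep_integral _ _ _ _ mu (~: A) _ _ (dep_setT (EFin \o f));
  rewrite finset.setDE finset.setCK finset.setTI.
Qed.

Lemma integral_marginal S A w : S \subset A -> I S (m A) w = m (A :\: S) w.
Proof.
move=> SA; rewrite /marginal -integral_overU ?finset.setCD 1?finset.setUC //.
  exact: mnn_density.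
by rewrite finset.disjoints_subset finset.setCK.
Qed.

Lemma marginal0 w : m finset.set0 w = 1.
Proof. by rewrite /marginal finset.setC0; case: df. Qed.

(** Otherwise some measure would be zero, and [f] could not integrate to 1. *)
Lemma integral_cst1_neq0 S w : I S (fun=> 1) w <> 0.
Proof.
move=> h; have m1 := mnn_cst T (lee01 : (0 : \bar R) <= 1); have mf := mnn_density.
have : I [set: V] (EFin \o f) w = 0.
  rewrite (integral_overD mu w mf (finset.subsetT S)).
  rewrite -[RHS](integral_over_zero mu ([set: V] :\: S) w).
  apply: eq_integral_over => w' _; apply: (integral_over_null m1 mf).
    rewrite -h; apply: (@dep_integral _ _ _ _ mu S finset.set0) => // v.
    by rewrite finset.set0D inE.
  by move=> w'' _ /eqP; rewrite onee_eq0.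
by case: df => _ _ -> /eqP; rewrite onee_eq0.
Qed.

Lemma mnn_cond B A : mnn (EFin \o cond mu f B A).
Proof.
split; last by move=> w; rewrite lee_fin divr_ge0 // fine_ge0 // marginal_ge0.
have mm S : measurable_fun [set: val]%classic (fine \o m S).
  apply: measurableT_comp; last exact: (mnn_marginal S).1.
  exact: fine_measurable.
apply/measurable_EFinP; apply: measurable_funM; first exact: mm.
(* The power with exponent -1 is 0 at 0, as is the inverse, so measurability of powers also covers
   the junk value. *)
rewrite (_ : (fun _ => _) = (fun x : R => powR x (-1)) \o (fine \o m A)).
  by apply: measurableT_comp; [exact: measurable_powR|exact: mm].
by apply: funext => w /=; rewrite powR_inv1 // fine_ge0 // marginal_ge0.
Qed.

Lemma cond_ge0 B A w : (0 <= cond mu f B A w)%R.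
Proof. by rewrite -lee_fin; exact: (mnn_cond B A).2. Qed.

Lemma dep_cond B A : depends_on (B :|: A) (EFin \o cond mu f B A).
Proof.
move=> w w' a; rewrite /= /cond (dep_marginal a) (@dep_marginal A w w') //.
by apply: agree_sub a; exact: finset.subsetUr.
Qed.

Lemma cond_undefined B A w : ~ cond_defined mu f A w -> cond mu f B A w = 0%R.
Proof.
rewrite /cond /cond_defined => nd.
suff -> : fine (m A w) = 0%R by rewrite invr0 mulr0.
have := marginal_ge0 A w; move: nd; case: (m A w) => [r| |] //= nd r0.
apply/eqP/contraT => rn; exfalso; apply: nd.
by rewrite ltry lte_fin lt_neqAle eq_sym rn -lee_fin r0.
Qed.

Lemma dep_cond_defined A w w' : agree_on A w w' ->
  cond_defined mu f A w -> cond_defined mu f A w'.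
Proof. by move=> a; rewrite /cond_defined (dep_marginal a). Qed.

Lemma integral_fine_marginal S A w : S \subset A -> m (A :\: S) w < +oo ->
  I S (fun w' => (fine (m A w'))%:E) w = m (A :\: S) w.
Proof.
move=> SA fin; rewrite -integral_marginal //; apply: aa_eq_integral.
- split; last by move=> w'; rewrite lee_fin fine_ge0 // marginal_ge0.
  apply/measurable_EFinP; apply: measurableT_comp; last exact: (mnn_marginal A).1.
  exact: fine_measurable.
- exact: mnn_marginal.
- apply: (aa_mono (aa_finite (mnn_marginal A) _)).
    by rewrite integral_marginal.
  by move=> w' _ lt; rewrite fineK // ge0_fin_numE // marginal_ge0.
Qed.

Lemma integral_cond1 B A w : [disjoint B & A] -> cond_defined mu f A w ->
  I B (EFin \o cond mu f B A) w = 1.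
Proof.
move=> BA /andP[pos fin].
have e : (B :|: A) :\: B = A.
  rewrite finset.setDUl finset.setDv finset.set0U; apply/finset.setDidPl.
  by rewrite disjoint_sym.
rewrite (@eq_integral_over _ _ _ _ _ B _
   (fun w' => (fine (m A w))^-1%:E * (fine (m (B :|: A) w'))%:E)); last first.
  move=> w' a; rewrite /= /cond EFinM muleC (@dep_marginal A w w') //.
  apply: agree_sub a; rewrite -finset.disjoints_subset disjoint_sym //.
have pf : m A w \is a fin_num by rewrite ge0_fin_numE // ltW.
have p0 : (fine (m A w) != 0)%R by rewrite fine_eq0 // gt_eqF.
rewrite integral_over_cstM.
- rewrite integral_fine_marginal ?finset.subsetUl ?e //.
  by rewrite -{2}(fineK pf) -EFinM mulVf.
- split; last by move=> w'; rewrite lee_fin fine_ge0 // marginal_ge0.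
  apply/measurable_EFinP; apply: measurableT_comp; last exact: (mnn_marginal _).1.
  exact: fine_measurable.
- by rewrite lee_fin invr_ge0 fine_ge0 // marginal_ge0.
Qed.

Lemma integral_cond_le1 B A w : [disjoint B & A] ->
  I B (EFin \o cond mu f B A) w <= 1.
Proof.
move=> BA; have [dA|nd] := pselect (cond_defined mu f A w).
  by rewrite integral_cond1.
rewrite (@eq_integral_over _ _ _ _ _ B _ (fun=> 0)) ?integral_over_zero //.
move=> w' a; rewrite /= cond_undefined // => dA; apply: nd.
apply: dep_cond_defined dA; apply/agree_sym; apply: agree_sub a.
by rewrite -finset.disjoints_subset disjoint_sym.
Qed.

Lemma marginal_finite w0 S : aa [set: V] w0 (fun w => m S w < +oo).
Proof.
have mS := mnn_marginal S; have my := mnn_cst T (leey (0 : \bar R)).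
have mE := measurable_eq mS my.
apply: (@aa_mono _ _ _ _ _ _ _ (fun w => ~ [set w | m S w = +oo]%classic w)).
  apply: (aa_sub mE (finset.subsetT S)) => w _.
  apply: (aa_mono (aa_finite mS _)).
    by rewrite integral_marginal // finset.setDv marginal0 ltey.
  by move=> w' _ lt /= e; rewrite e ltxx in lt.
by move=> w _ /= ne; rewrite lt_neqAle leey andbT; apply/eqP.
Qed.

(** Restricted to the set where f(s) is 0, [f] integrates to f(s) over the remaining coordinates,
    that is, to 0. *)
Lemma marginal_neq0 w0 S : aa [set: V] w0 (fun w => f w = 0%R \/ m S w <> 0).
Proof.
have mS := mnn_marginal S; have m0 := mnn_cst T (lexx (0 : \bar R)).
have mE := measurable_eq mS m0; have mi := mnn_ind R mE; have mf := mnn_density.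
have := @aa_zero _ _ _ _ mu [set: V] w0 _ (mnn_mul mi mf).
move=> /(_ _)/aa_mono; apply; last first.
  move=> w _ /eqP; rewrite mule_eq0 => /orP[/eqP/ind_eq0|/eqP[]]; [by right|by left].
rewrite (integral_overD mu w0 (mnn_mul mi mf) (finset.subsetT (~: S))).
rewrite -[RHS](integral_over_zero mu ([set: V] :\: ~: S) w0).
apply: eq_integral_over => w _.
have di : depends_on S (indicator R [set w | m S w = 0]%classic).
  move=> w1 w2 a; have [e|e] := pselect (m S w1 = 0).
    by rewrite !ind1 //= (dep_marginal a).
  by rewrite !ind0 //= (dep_marginal a).
rewrite (integral_overM mu w mf mi.2 di); last by rewrite finset.disjoints_subset finset.setCK.
have [e|ne] := pselect (m S w = 0); first by rewrite -/(m S w) e mule0.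
by rewrite ind0 // mul0e.
Qed.

End Marginals.

(** * Factorization over a DAG *)

Section Factorization.
Variables (R : realType) (V : finType) (d : V -> measure_display).
Variable T : forall v, measurableType (d v).
Variable mu : forall v, {sigma_finite_measure set (T v) -> \bar R}.
Local Open Scope ereal_scope.
Local Notation val := (values T).
Implicit Types (w : val) (S K A B : {set V}).
Local Notation I := (integral_over mu).
Local Notation aa := (almost_all mu).
Variable f : val -> R.
Hypothesis df : density mu f.
Local Notation m := (marginal mu f).
Variable D : graph V.
Hypothesis dD : dag D.

Definition dag_cond v : val -> R := cond mu f [set v] (Pa [set v] D).

Definition dag_prod S w : R := (\prod_(v in S) dag_cond v w)%R.

Lemma cond_prod_dag_factors S w : cond_prod mu f (dag_factors D S) w = dag_prod S w.
Proof.
exact: (dag_factors_prod D S (fun B A => cond mu f B A w)).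
Qed.

Lemma mnn_dag_cond v : mnn (EFin \o dag_cond v).
Proof. exact: mnn_cond. Qed.

Lemma mnn_dag_prod S : mnn (EFin \o dag_prod S).
Proof.
split; last by move=> w; rewrite lee_fin prodr_ge0 // => v _; exact: cond_ge0.
apply/measurable_EFinP.
rewrite (_ : dag_prod S = fun w => \prod_(v <- enum S) dag_cond v w)%R.
  by apply: measurable_prod => v _; apply/measurable_EFinP; exact: (mnn_dag_cond v).1.
by apply: funext => w; rewrite big_enum.
Qed.

Lemma dag_prod_ge0 S w : (0 <= dag_prod S w)%R.
Proof. by rewrite -lee_fin; exact: (mnn_dag_prod S).2. Qed.

Lemma dep_dag_prod S K : S \subset K ->
  (forall u v, v \in S -> dir D u v -> u \in K) -> depends_on K (EFin \o dag_prod S).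
Proof.
move=> /fintype.subsetP SK PK w w' a; rewrite /= /dag_prod; congr (_ %:E).
apply: eq_bigr => v vS; apply: EFin_inj.
apply: (@dep_cond _ _ _ _ mu f [set v] (Pa [set v] D) w w') => u.
rewrite finset.in_setU finset.in_set1 mem_Pa1 => /predU1P[->|uv]; first exact/a/SK.
by apply: a; exact: PK uv.
Qed.

Lemma dag_prodD1 S v w : v \in S -> dag_prod S w = (dag_prod (S :\ v) w * dag_cond v w)%R.
Proof.
move=> vS; rewrite /dag_prod (bigD1 v) //= mulrC; congr (_ * _)%R.
by apply: eq_bigl => u; rewrite finset.in_setD1 andbC.
Qed.

Lemma dag_prodU S S' w : [disjoint S & S'] ->
  dag_prod (S :|: S') w = (dag_prod S w * dag_prod S' w)%R.
Proof.
by move=> dis; rewrite /dag_prod -bigU //=; apply: eq_bigl => u; rewrite finset.in_setU.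
Qed.

Lemma integral_sink S v w : v \in S -> (forall u, u \in S -> dir D v u = false) ->
  I [set v] (EFin \o dag_prod S) w =
  (dag_prod (S :\ v) w)%:E * I [set v] (EFin \o dag_cond v) w.
Proof.
move=> vS sink.
rewrite -(@integral_overM _ _ _ _ mu _ (~: [set v]) (EFin \o dag_prod (S :\ v))).
- by apply: eq_integral_over => w' _ /=; rewrite (dag_prodD1 w' vS).
- exact: mnn_dag_cond.
- exact: (mnn_dag_prod _).2.
- apply: dep_dag_prod => [|u u'].
    by apply/fintype.subsetP => u; rewrite !inE => /andP[].
  by rewrite !inE => /andP[_ u'S]; apply: contraTneq => ->; rewrite sink.
- by rewrite finset.disjoints_subset.
Qed.

Lemma disjoint_Pa v : [disjoint [set v] & Pa [set v] D].
Proof.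
rewrite disjoint_subset; apply/fintype.subsetP => u.
by rewrite finset.in_set1 inE => /eqP->; rewrite mem_Pa1 dir_irr.
Qed.

(** The induction step for integrating out [S :\: S']: as no arrow goes from there into [S'], a sink
    of the difference is a sink of all of [S], and its removal preserves the situation. *)
Lemma difference_sink S S' : S' \subset S -> S :\: S' != finset.set0 ->
  (forall u v, v \in S :\: S' -> u \in S' -> dir D v u = false) ->
  exists v, [/\ v \in S :\: S', S' \subset S :\ v,
    forall u, u \in S -> dir D v u = false,
    S :\: S' :\ v = (S :\ v) :\: S' &
    forall u v', v' \in (S :\ v) :\: S' -> u \in S' -> dir D v' u = false].
Proof.
move=> SS /finset.set0Pn[v0 v0S] cl; have [v vS sink] := dag_sink dD v0S.
exists v; split => //.
- rewrite finset.subsetD1 SS /=; by move: vS; rewrite finset.in_setD => /andP[].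
- move=> u uS; have [uS'|uS'] := boolP (u \in S'); first exact: cl.
  by apply: sink; rewrite finset.in_setD uS'.
- by apply/finset.setP => u; rewrite !inE; case: (u == v); rewrite ?andbF.
- move=> u v'; rewrite finset.in_setD finset.in_setD1 => /and3P[v'S' _ v'S]; apply: cl.
  by rewrite finset.in_setD v'S'.
Qed.

(** Each sink contributes the integral of its own factor only. This is 1, or 0 where the factor is
    not defined, whence an inequality. *)
Lemma integral_dag_prod_le S S' w : S' \subset S ->
  (forall u v, v \in S :\: S' -> u \in S' -> dir D v u = false) ->
  I (S :\: S') (EFin \o dag_prod S) w <= (dag_prod S' w)%:E.
Proof.
move: {2}#|S :\: S'| (leqnn #|S :\: S'|) => n; elim: n S w => [|n IH] S w.
  rewrite leqn0 cards_eq0 => /eqP e SS _; rewrite e integral_over0.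
  suff -> : S = S' by [].
  by apply/eqP; rewrite finset.eqEsubset SS andbT -finset.setD_eq0 e.
move=> Sn SS cl; have [e0|ne] := eqVneq (S :\: S') finset.set0.
  by apply: IH => //; rewrite e0 cards0.
have [v [vS SSv sink eD cl']] := difference_sink SS ne cl.
have vS1 : v \in S by move: vS; rewrite finset.in_setD => /andP[].
have sv : [set v] \subset S :\: S' by rewrite finset.sub1set.
rewrite (integral_overD mu w (mnn_dag_prod S) sv) eD.
apply: (@le_trans _ _ (I ((S :\ v) :\: S') (EFin \o dag_prod (S :\ v)) w)); last first.
  apply: IH => //; rewrite -eD -ltnS (leq_trans _ Sn) //.
  by rewrite [X in (_ < X)%N](cardsD1 v) vS.
apply: le_integral_over; [exact/mnn_integral/mnn_dag_prod|exact: mnn_dag_prod|].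
move=> w' _; rewrite integral_sink // -[leRHS]mule1.
apply: lee_pmul => //; first by rewrite lee_fin dag_prod_ge0.
- exact: (mnn_integral _ _ (mnn_dag_cond v)).2.
- by apply: (integral_cond_le1 df); exact: disjoint_Pa.
Qed.

Section Closed.
Variable w0 : val.
Hypothesis f_le : aa [set: V] w0 (fun w => (f w <= dag_prod [set: V] w)%R).

Definition parent_closed S := forall u v, v \in S -> dir D u v -> u \in S.

Lemma marginal_le_dag_prod S : parent_closed S ->
  aa [set: V] w0 (fun w => m S w <= (dag_prod S w)%:E).
Proof.
move=> cS; have := aa_fubini (finset.subsetT (~: S)) f_le.
move=> /aa_mono; apply=> w _ h.
apply: (@le_trans _ _ (I (~: S) (EFin \o dag_prod [set: V]) w)).
  apply: aa_le_integral; [exact: (mnn_density df)|exact: mnn_dag_prod|].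
  by apply: (aa_mono h) => w' _; rewrite lee_fin.
rewrite -finset.setTD; apply: integral_dag_prod_le => //.
move=> u v; rewrite finset.in_setD inE andbT => vS uS; apply/negP => vu.
by case/negP: vS; exact: cS vu.
Qed.

(* Both sides integrate to at most 1 and the smaller one to 1. *)
Lemma marginal_dag_prod S : parent_closed S ->
  aa [set: V] w0 (fun w => m S w = (dag_prod S w)%:E).
Proof.
move=> cS; have mS := mnn_marginal df S; have mF := mnn_dag_prod S.
have mE := measurable_ne mS mF.
have dF : depends_on S (EFin \o dag_prod S) by apply: dep_dag_prod => //.
pose N := (~` [set w | m S w <= (dag_prod S w)%:E])%classic.
have mN : measurable N.
  apply: measurableC; rewrite -[X in measurable X]setTI.
  exact: measurable_lee mS.1 mF.1.
have dN : depends_on S (indicator R N).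
  move=> w1 w2 a; have e2 : dag_prod S w2 = dag_prod S w1 := EFin_inj (dF _ _ a).
  have eN : N w2 = N w1 by rewrite /N /setC /mkset /= (dep_marginal mu f a) e2.
  by have [n|n] := pselect (N w1); [rewrite !ind1 ?eN|rewrite !ind0 ?eN].
(* Both sides involve only the coordinates in [S], so the inequality passes from almost all points
   of the whole space to the slice through any [w]. *)
have lS w : aa S w (fun w => m S w <= (dag_prod S w)%:E).
  suff : aa S w0 (fun w => ~ N w).
    move/(proj1 (aa_measurable _ _ _ mN)) => h.
    have : I S (indicator R N) w = 0.
      rewrite -h; apply: (@dep_integral _ _ _ _ mu S S _ dN) => v.
      by rewrite finset.setDv inE.
    move/(proj2 (aa_measurable _ _ _ mN))/aa_mono; apply => w' _; exact: contrapT.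
  apply: (@aa_dep _ _ _ _ mu S w0 (EFin \o f)) => //.
  - exact: (mnn_density df).
  - by case: df => _ _ -> /eqP; rewrite onee_eq0.
  - apply: (aa_mono (marginal_le_dag_prod cS)) => w' _ h nh; exact: nh h.
have int1 w : I S (m S) w = 1.
  by rewrite integral_marginal // finset.setDv marginal0.
(* The positive part makes the excess nonnegative everywhere; almost everywhere it is the difference
   itself. *)
pose h w := Order.max 0%R (dag_prod S w - fine (m S w))%R.
have mh : mnn (EFin \o h).
  split; last by move=> w; rewrite lee_fin le_max lexx.
  apply/measurable_EFinP; apply: measurable_maxr; first exact: measurable_cst.
  apply: measurable_funB; first by apply/measurable_EFinP; exact: mF.1.
  by apply: measurableT_comp; [exact: fine_measurable|exact: mS.1].
have lt1 w : aa S w (fun w => m S w < +oo).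
  by apply: aa_finite => //; rewrite int1 ltey.
have eq w : aa S w (fun w => m S w = (dag_prod S w)%:E).
  have e : aa S w (fun w => (dag_prod S w)%:E = m S w + (h w)%:E).
    apply: (aa_mono (aa_and (lS w) (lt1 w))) => w' _ [le lt].
    have fm : m S w' \is a fin_num by rewrite ge0_fin_numE // (marginal_ge0 df).
    rewrite /h -{1}(fineK fm) -EFinD; congr (_ %:E).
    rewrite (@max_r _ _ 0%R) 1?addrC ?subrK //.
    by rewrite addrC subr_ge0 -lee_fin fineK.
  (* The integral of the product is 1 plus that of [h], and it is at most the empty product 1. *)
  have h0 : I S (EFin \o h) w = 0.
    have := @integral_dag_prod_le S finset.set0 w (finset.sub0set _).
    rewrite finset.setD0 => /(_ _)/le_trans/(_ (_ : _ <= 1)).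
    have -> : dag_prod finset.set0 w = 1%R by rewrite /dag_prod big_set0.
    rewrite (aa_eq_integral mF (mnn_add mS mh) e) integral_overDr // int1.
    move=> /(_ _ (lexx _)); rewrite -[leRHS]adde0 leeD2lE // => /(_ _) le0.
    apply/eqP; rewrite eq_le (mnn_integral mu S mh).2 andbT le0 // => u v _.
    by rewrite inE.
  apply: (aa_mono (aa_and e (aa_zero mh h0))) => w' _ [-> /= ->].
  by rewrite adde0.
suff : aa [set: V] w0 (fun w => ~ [set w | m S w <> (dag_prod S w)%:E]%classic w).
  by move=> /aa_mono; apply => w _ /=; exact: contrapT.
apply: (aa_sub mE (finset.subsetT S)) => w _.
by apply: (aa_mono (eq w)) => w' _ e ne; exact: ne e.
Qed.

End Closed.

End Factorization.

(** * Conditional densities of components and truncated products *)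

Section Main.
Variables (R : realType) (V : finType) (d : V -> measure_display).
Variable T : forall v, measurableType (d v).
Variable mu : forall v, {sigma_finite_measure set (T v) -> \bar R}.
Local Open Scope ereal_scope.
Local Notation val := (values T).
Implicit Types (w : val) (S K A B : {set V}).
Local Notation I := (integral_over mu).
Local Notation aa := (almost_all mu).
Variable f : val -> R.
Hypothesis df : density mu f.
Local Notation m := (marginal mu f).
Variable D : graph V.
Hypothesis dD : dag D.
Local Notation condD := (dag_cond mu f D).
Local Notation prodD := (dag_prod mu f D).

(** Where [f] is 0 the bound is trivial. Almost everywhere else all marginals are finite and
    positive, so [markov_equiv_prod] turns the product over [D'] into the one over [D]. *)
Lemma density_le_dag_prod D' w0 : dag D' -> adj D' =2 adj D ->
  (forall a b c, unshielded_collider D' a b c = unshielded_collider D a b c) ->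
  consistent_dag mu f D' -> aa [set: V] w0 (fun w => (f w <= prodD [set: V] w)%R).
Proof.
move=> dD' ea ec [_ /(_ w0) cf].
have fin := aa_all (fun S => marginal_finite df w0 S).
have pos := aa_all (fun S => marginal_neq0 df w0 S).
apply: (aa_mono (aa_and cf (aa_and fin pos))) => w _ [ef [fw pw]].
have [->|fn0] := eqVneq (f w) 0%R; first exact: dag_prod_ge0.
have a0 S : fine (m S w) != 0%R.
  have [e|/eqP ne] := pw S; first by rewrite e eqxx in fn0.
  by rewrite fine_eq0 // ge0_fin_numE // (marginal_ge0 df).
rewrite ef cond_prod_dag_factors /dag_prod /dag_cond /cond.
under eq_bigl do rewrite inE.
under [leRHS]eq_bigl do rewrite inE.
by rewrite (markov_equiv_prod dD' dD ea ec a0).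
Qed.

Section Component.
Variable w0 : val.
Hypothesis f_le : aa [set: V] w0 (fun w => (f w <= prodD [set: V] w)%R).
Local Notation parent_closed := (parent_closed D).

(* [Q] allows to read off f(C | P) from the ancestral sets [Q] and [Q :|: C].
   Where f(P) is not defined both sides are 0: a source of D in [C] has exactly
   the parents [P]. *)
Lemma integral_component (Q C B P : {set V}) : parent_closed Q ->
  (forall u v, v \in C -> dir D u v -> u \in C :|: P) ->
  (forall u v, v \in C -> u \in P -> dir D u v) ->
  P \subset Q -> [disjoint Q & C] -> B \subset C -> C != finset.set0 ->
  aa [set: V] w0 (fun w => I (C :\: B) (EFin \o prodD C) w = (cond mu f B P w)%:E).
Proof.
move=> cQ PC CP PQ QC BC /finset.set0Pn[v0 v0C].
have cQC : parent_closed (Q :|: C).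
  move=> u v; rewrite !inE => /orP[vQ|vC] uv; first by rewrite (cQ _ _ vQ uv).
  have := PC _ _ vC uv; rewrite inE => /orP[->|/(fintype.subsetP PQ)->//].
  by rewrite orbT.
have PCdis : [disjoint P & C] by exact: disjointWl PQ QC.
have CQdis : [disjoint Q :\: P & C :\: B].
  by apply: disjointWl (finset.subsetDl _ _) _; apply: disjointWr QC; exact: finset.subsetDl.
have e1 := marginal_dag_prod df dD f_le cQC.
have e2 := marginal_dag_prod df dD f_le cQ.
have e3 := aa_fubini (finset.subsetT ((Q :\: P) :|: (C :\: B))) (aa_and e1 e2).
apply: (aa_mono (aa_and e3 (marginal_finite df w0 (B :|: P)))) => w _ [e finBP].
pose g := I (C :\: B) (EFin \o prodD C).
have mg : mnn g by apply: mnn_integral; exact: mnn_dag_prod.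
have mmul : mnn (fun w => m Q w * (prodD C w)%:E).
  by apply: mnn_mul; [exact: mnn_marginal|exact: (mnn_dag_prod df D C)].
(* The product over [Q :|: C] is f(q) times the product over [C]. Integrating out [C :\: B] turns
   the latter into [g], which is constant in the coordinates of [Q :\: P]; integrating these out
   leaves f(p). *)
have eqm : m (B :|: P) w = g w * m P w.
  have -> : m (B :|: P) w = I ((Q :\: P) :|: (C :\: B)) (m (Q :|: C)) w.
    rewrite integral_marginal //; last first.
      by apply: finset.setUSS; exact: finset.subsetDl.
    congr (m _ w); apply/finset.setP => u; rewrite !inE.
    have := fintype.subsetP BC u; have := fintype.subsetP PQ u.
    have := disjointFr QC (x := u); have := disjointFr PCdis (x := u).
    case: (u \in B); case: (u \in P); case: (u \in Q); case: (u \in C) => //= h1 h2 h3 h4;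
      first [by have := h1 isT|by have := h2 isT|by have := h3 isT|by have := h4 isT].
  have -> : I ((Q :\: P) :|: (C :\: B)) (m (Q :|: C)) w =
            I ((Q :\: P) :|: (C :\: B)) (fun w => m Q w * (prodD C w)%:E) w.
    apply: aa_eq_integral => //; first exact: mnn_marginal.
    apply: (aa_mono e) => w' _ [-> ->].
    by rewrite (dag_prodU _ _ _ _ QC) EFinM.
  rewrite integral_overU //.
  transitivity (I (Q :\: P) (fun w => g w * m Q w) w).
    apply: eq_integral_over => w' _; rewrite muleC.
    rewrite (@integral_overM _ _ _ _ mu _ Q) //; first exact: (mnn_dag_prod df D C).
    - by move=> w''; exact: (marginal_ge0 df).
    - exact: dep_marginal.
    - by apply: disjointWr QC; exact: finset.subsetDl.
  rewrite (@integral_overM _ _ _ _ mu _ (C :|: P)).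
  - rewrite integral_marginal ?finset.subsetDl // (_ : Q :\: (Q :\: P) = P) //.
    by rewrite finset.setDDr finset.setDv finset.set0U; apply/finset.setIidPr.
  - exact: mnn_marginal.
  - exact: mg.2.
  - apply: (dep_sub (K := (C :|: P) :\: (C :\: B))); first exact: finset.subsetDl.
    apply: dep_integral; apply: dep_dag_prod => //; exact: finset.subsetUl.
  - rewrite finset.disjoints_subset; apply/fintype.subsetP => u; rewrite !inE.
    have := disjointFr QC (x := u); have := disjointFr PCdis (x := u).
    case: (u \in P); case: (u \in Q); case: (u \in C) => //= h1 h2;
      first [by have := h1 isT|by have := h2 isT].
have [dP|nP] := pselect (cond_defined mu f P w).
  case/andP: dP => pos fin.
  have pf : m P w \is a fin_num by rewrite ge0_fin_numE // ltW.
  have p0 : (fine (m P w) != 0)%R by rewrite fine_eq0 // gt_eqF.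
  have gfin : g w \is a fin_num.
    rewrite ge0_fin_numE; last exact: mg.2.
    apply: contraLR finBP; rewrite -!leNgt leye_eq => /eqP e'.
    by rewrite eqm e' gt0_mulye.
  rewrite -/(g w) /cond eqm fineM // mulfK // fineK //.
rewrite cond_undefined // -[RHS](integral_over_zero mu (C :\: B) w).
apply: eq_integral_over => w' a; congr (_ %:E).
have [v vC source] := dag_source dD v0C.
rewrite /dag_prod (bigD1 v) //= /dag_cond.
have -> : Pa [set v] D = P.
  apply/finset.setP => u; rewrite mem_Pa1; apply/idP/idP => [uv|]; last exact: CP.
  by have := PC _ _ vC uv; rewrite inE => /orP[/source|//]; rewrite uv.
rewrite cond_undefined ?mul0r // => dP; apply: nP; apply: dep_cond_defined dP.
apply/agree_sym; apply: agree_sub a; rewrite -finset.disjoints_subset.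
by apply: disjointWr PCdis; exact: finset.subsetDl.
Qed.

End Component.

Section Slice.
Variables (X : {set V}) (w : val).
Local Notation defined S w := (cond_prod_defined mu f (dag_factors D S) w).

(* Definedness of a product survives the removal of a sink [v]: where f(pa(v))
   is defined, [v] has a value with positive density, so that the vanishing
   factor, if any, is not the one of [v]. *)
Lemma defined_sink S v : S \subset ~: X -> v \in S ->
  (forall u, u \in S -> dir D v u = false) ->
  aa (~: X) w (fun w' => defined S w') ->
  aa (~: X) w (fun w' => defined (S :\ v) w' /\
     I [set v] (EFin \o prodD S) w' = (prodD (S :\ v) w')%:E).
Proof.
move=> SX vS sink h.
have vX : [set v] \subset ~: X.
  by rewrite finset.sub1set; exact: (fintype.subsetP SX).
apply: (aa_mono (aa_fubini vX h)) => w' _ {}h.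
have mem u S' : (([set u], Pa [set u] D) \in dag_factors D S') = (u \in S').
  rewrite -[RHS]mem_enum; apply/mapP/idP => [[x xS [/finset.set1_inj->]] //|uS].
  by exists u.
(* As [v] is a sink of [S], moving along its coordinate changes neither the definedness of any
   factor nor the value of the other factors. *)
have tr w1 w2 u : agree_on (~: [set v]) w1 w2 -> u \in S ->
    cond_defined mu f (Pa [set u] D) w1 -> cond_defined mu f (Pa [set u] D) w2.
  move=> a uS; apply: dep_cond_defined; apply: agree_sub a.
  apply/fintype.subsetP => x; rewrite mem_Pa1 !inE.
  by apply: contraTneq => ->; rewrite sink.
have trc w1 w2 u : agree_on (~: [set v]) w1 w2 -> u \in S :\ v ->
    condD u w2 = condD u w1.
  rewrite finset.in_setD1 => a /andP[uv uS].
  apply: EFin_inj; apply: (@dep_cond _ _ _ _ mu f [set u] (Pa [set u] D) w1 w2).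
  apply: agree_sub a; apply/fintype.subsetP => x; rewrite finset.in_setU mem_Pa1 !inE.
  by move=> /predU1P[->//|]; apply: contraTneq => ->; rewrite sink.
have fact c S' : c \in dag_factors D S' -> exists2 u, u \in S' & c = ([set u], Pa [set u] D).
  by case/mapP => u; rewrite mem_enum => uS ->; exists u.
have m1 := mnn_cst T (lee01 : (0 : \bar R) <= 1).
rewrite integral_sink //.
have [dv|nv] := pselect (cond_defined mu f (Pa [set v] D) w').
  have i1 : I [set v] (EFin \o condD v) w' = 1.
    by apply: integral_cond1 => //; exact: disjoint_Pa.
  rewrite i1 mule1; split=> //.
  have [||w1 [a dw1 nz]] := @aa_exists _ _ _ _ mu _ _ _ (EFin \o condD v) h.
  - exact: mnn_dag_cond.
  - by rewrite i1 => /eqP; rewrite onee_eq0.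
  have a' := agree_sym a.
  case: dw1 => [al|[c [cS dc zc]]]; [left|right].
    move=> c /fact[u]; rewrite finset.in_setD1 => /andP[_ uS] ->.
    by apply: (tr _ _ _ a' uS); apply: (al ([set u], _)); rewrite mem.
  have [u uS ec] := fact _ _ cS.
  have uSv : u \in S :\ v.
    rewrite finset.in_setD1 uS andbT; apply/eqP => uv; apply: nz.
    by rewrite ec uv in zc; rewrite /= /dag_cond zc.
  exists ([set u], Pa [set u] D); split; first by rewrite mem.
    by apply: (tr _ _ _ a' uS); rewrite ec in dc.
  by rewrite -/(condD u w') (trc _ _ _ a' uSv); rewrite ec in zc.
(* Where f(pa(v)) is not defined, any point of the line on which the product is defined will do:
   there the defined vanishing factor belongs to another node, and it makes both sides 0. *)
have [||w1 [a dw1 _]] := @aa_exists _ _ _ _ mu _ _ _ (fun=> 1) h.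
- exact: m1.
- exact: (integral_cst1_neq0 df).
have a' := agree_sym a.
case: dw1 => [al|[c [cS dc zc]]].
  case: nv; apply: (tr _ _ _ a' vS); apply: (al ([set v], _)); by rewrite mem.
have [u uS ec] := fact _ _ cS.
have uSv : u \in S :\ v.
  rewrite finset.in_setD1 uS andbT; apply/eqP => uv; apply: nv.
  by rewrite ec uv in dc; exact: (tr _ _ _ a' vS).
have zu : condD u w' = 0%R.
  by rewrite (trc _ _ _ a' uSv); rewrite ec in zc.
split.
  right; exists ([set u], Pa [set u] D); split => //; first by rewrite mem.
  by apply: (tr _ _ _ a' uS); rewrite ec in dc.
suff -> : prodD (S :\ v) w' = 0%R by rewrite mul0e.
by rewrite /dag_prod (bigD1 u) //= zu mul0r.
Qed.

(** The equality behind [integral_dag_prod_le]: definedness excludes the loss at undefined factors,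
    provided it is carried along at each removal of a sink. *)
Lemma integral_defined S S' : S' \subset S -> S \subset ~: X ->
  (forall u v, v \in S :\: S' -> u \in S' -> dir D v u = false) ->
  aa (~: X) w (fun w' => defined S w') ->
  aa (~: X) w (fun w' => I (S :\: S') (EFin \o prodD S) w' = (prodD S' w')%:E).
Proof.
move: {2}#|S :\: S'| (leqnn #|S :\: S'|) => n; elim: n S => [|n IH] S.
  rewrite leqn0 cards_eq0 => /eqP e SS _ _ _; apply: aa_true => w' _.
  rewrite e integral_over0; suff -> : S = S' by [].
  by apply/eqP; rewrite finset.eqEsubset SS andbT -finset.setD_eq0 e.
move=> Sn SS SX cl def; have [e0|ne] := eqVneq (S :\: S') finset.set0.
  by apply: IH => //; rewrite e0 cards0.
have [v [vS SSv sink eD cl']] := difference_sink dD SS ne cl.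
have vS1 : v \in S by move: vS; rewrite finset.in_setD => /andP[].
have sv : [set v] \subset S :\: S' by rewrite finset.sub1set.
have step := defined_sink SX vS1 sink def.
have SvX : S :\ v \subset ~: X by apply: fintype.subset_trans SX; exact: finset.subsetDl.
have rX : (S :\ v) :\: S' \subset ~: X.
  by apply: fintype.subset_trans SvX; exact: finset.subsetDl.
have ih : aa (~: X) w (fun w' =>
    I ((S :\ v) :\: S') (EFin \o prodD (S :\ v)) w' = (prodD S' w')%:E).
  apply: IH => //; last by apply: (aa_mono step) => w' _ [].
  rewrite -eD -ltnS (leq_trans _ Sn) //.
  by rewrite [X in (_ < X)%N](cardsD1 v) vS.
have mF S0 : mnn (EFin \o prodD S0) by exact: mnn_dag_prod.
apply: (aa_mono (aa_and ih (aa_fubini rX step))) => w' _ [<- e].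
rewrite (integral_overD mu w' (mF S) sv) eD.
apply: aa_eq_integral => //; first exact: mnn_integral.
by apply: (aa_mono e) => w'' _ [].
Qed.

End Slice.

End Main.

(** * The identification formula *)

Section Identification.
Variables (R : realType) (V : finType) (d : V -> measure_display).
Variable T : forall v, measurableType (d v).
Variable mu : forall v, {sigma_finite_measure set (T v) -> \bar R}.
Local Open Scope ereal_scope.
Local Notation val := (values T).
Local Notation I := (integral_over mu).
Local Notation aa := (almost_all mu).
Variables (f : val -> R) (G D : graph V) (X Y : {set V}) (Bs : seq {set V}).
Hypotheses (df : density mu f) (mpG : mpdag G) (rep : represented G D).
Hypothesis dXY : [disjoint X & Y].
Hypothesis no_path : ~ (exists (x : V) (p : seq V),
       [/\ x \in X, last x p \in Y, possibly_causal G x p, proper_wrt X p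
         & starts_undirected G x p]).
Local Notation Z := (avoiding_ancestors D X Y).
Local Notation A := (An Y (induced_subgraph G (~: X))).
Local Notation prodD := (dag_prod mu f D).
Local Notation comps := (buckets G [set: V]).
Hypothesis pcoBs : PCO A G Bs.
Implicit Types (w : val) (C : {set V}).

Let dD : dag D. Proof. by case: rep. Qed.

Lemma bucket_prodE w : cond_prod mu f (bucket_factors G Bs) w =
  (\prod_(C in comps) if C :&: A != finset.set0
     then cond mu f (C :&: A) (Pa C G) w else 1)%R.
Proof.
rewrite /cond_prod big_map.
have := pco_loop_perm pcoBs; rewrite cats0 => pe.
rewrite (perm_big _ pe) /= big_map big_filter big_enum_cond /= big_mkcondr /=.
apply: eq_bigr => C; rewrite mem_buckets => /existsP[u /eqP->]; case: ifP => // ne.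
by rewrite (Pa_bucket mpG rep dXY no_path ne).
Qed.

Lemma mnn_do_density : mnn (EFin \o do_density mu f D X).
Proof.
rewrite (_ : do_density mu f D X = if X == finset.set0 then f else prodD (~: X)).
  by case: ifP => _; [exact: (mnn_density df)|exact: mnn_dag_prod].
apply: funext => w; rewrite /do_density; case: ifP => // _.
exact: cond_prod_dag_factors.
Qed.

Lemma mnn_bucket_prod : mnn (EFin \o cond_prod mu f (bucket_factors G Bs)).
Proof.
split; last by move=> w; rewrite lee_fin prodr_ge0 // => c _; exact: (cond_ge0 df).
apply/measurable_EFinP; apply: measurable_prod => c _.
by apply/measurable_EFinP; exact: (mnn_cond df _ _).1.
Qed.

Lemma Z_component_empty C : C \in comps -> C :&: A = finset.set0 ->
  C :&: Z = finset.set0.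
Proof.
rewrite mem_buckets => /existsP[u /eqP->] e; apply/eqP/negPn/negP => /finset.set0Pn[z].
rewrite finset.in_setI => /andP[zu zZ].
by have := component_Z_A mpG rep dXY zu zZ; rewrite e eqxx.
Qed.

(** The integral splits because the parents of [C :&: Z] lie in it or in [Pa C G], and the latter is
    contained in [A :|: X] when [C] meets [A]. So no factor depends on variables integrated for
    another component. *)
Lemma integral_outside_A w :
  I (Z :\: A) (EFin \o prodD Z) w =
  \big[mule/1]_(C <- enum comps) I ((C :&: Z) :\: A) (EFin \o prodD (C :&: Z)) w.
Proof.
have AZ := A_sub_Z X Y rep.
have dis i j : i \in enum comps -> j \in enum comps -> i != j -> [disjoint i & j].
  by rewrite !mem_enum; exact: buckets_disjoint.
rewrite -(@integral_over_prod _ _ _ _ mu _ (enum comps) (fun C => (C :&: Z) :\: A)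
  (fun C => (C :&: Z) :|: (A :|: X)) (fun C => prodD (C :&: Z))).
- have -> : \bigcup_(C <- enum comps) (C :&: Z :\: A) = Z :\: A.
    apply/finset.setP => v; rewrite mem_bigcup_seq; apply/hasP/idP => [[C _]|].
      by rewrite !finset.in_setD finset.in_setI => /and3P[-> _ ->].
    move=> vZA; exists (component G v).
      by rewrite mem_enum mem_buckets; apply/existsP; exists v.
    move: vZA; rewrite !finset.in_setD finset.in_setI component_refl /=.
    by [].
  apply: eq_integral_over => w' _ /=; congr (_ %:E).
  rewrite big_enum /dag_prod (partition_big (component G) (mem comps)) /=; last first.
    by move=> v _; rewrite mem_buckets; apply/existsP; exists v.
  apply: eq_bigr => C; rewrite mem_buckets => /existsP[u /eqP->].
  apply: eq_bigl => v; rewrite finset.in_setI andbC; congr (_ && _).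
  apply/eqP/idP => [<-|]; [exact: component_refl|exact: component_eq].
- exact: enum_uniq.
- by move=> C; exact: mnn_dag_prod.
- move=> C; rewrite mem_enum mem_buckets => /existsP[u /eqP->].
  have [e|/finset.set0Pn[z]] := eqVneq (component G u :&: Z) finset.set0.
    by move=> w1 w2 _; rewrite e /dag_prod !big_set0.
  rewrite finset.in_setI => /andP[zu zZ].
  have /finset.set0Pn[a] := component_Z_A mpG rep dXY zu zZ.
  rewrite finset.in_setI => /andP[au aA].
  apply: dep_dag_prod; first exact: finset.subsetUl.
  move=> x v; rewrite finset.in_setI => /andP[vu vZ] xv.
  have xP : x \in Pa [set v] D by rewrite mem_Pa1.
  rewrite (PaD_component mpG rep vu) finset.in_setU in xP.
  rewrite finset.in_setU; case/orP: xP => [xP|xP].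
    by rewrite (fintype.subsetP (Pa_component_A mpG rep dXY au aA)) // orbT.
  rewrite finset.in_setI (fintype.subsetP (PaD_component_Z mpG rep dXY no_path vu vZ)) //.
  by move: xP; rewrite finset.in_setI => /andP[_ ->].
- move=> C C' Ci Cj ne; rewrite disjoint_subset; apply/fintype.subsetP => v.
  rewrite !inE => /and3P[_ vC _]; by rewrite (disjointFr (dis _ _ Ci Cj ne) vC) andbF.
- move=> C C' Ci Cj ne; rewrite disjoint_subset; apply/fintype.subsetP => v.
  move=> h; rewrite inE; apply/negP; rewrite finset.in_setD finset.in_setI.
  move=> /and3P[vA vC' vZ]; move: h; rewrite finset.in_setU finset.in_setU (negbTE vA).
  rewrite (negbTE (Z_notin_X dXY vZ)) => /orP[|//].
  rewrite finset.in_setI => /andP[vC _].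
  by rewrite (disjointFr (dis _ _ Ci Cj ne) vC) in vC'.
Qed.

Definition component_identity w := forall C, C \in comps -> C :&: A != finset.set0 ->
  I ((C :&: Z) :\: A) (EFin \o prodD (C :&: Z)) w =
  (cond mu f (C :&: A) (Pa C G) w)%:E.

Lemma component_identity_ae w0 :
  aa [set: V] w0 (fun w => (f w <= prodD [set: V] w)%R) ->
  aa [set: V] w0 component_identity.
Proof.
move=> f_le; apply: aa_all => C.
have [Cc|nC] := boolP (C \in comps); last by apply: aa_true.
have [CA|ne] := eqVneq (C :&: A) finset.set0; first by apply: aa_true => w _ _ /eqP.
suff h : aa [set: V] w0 (fun w => I ((C :&: Z) :\: (C :&: A)) (EFin \o prodD (C :&: Z)) w =
    (cond mu f (C :&: A) (Pa C G) w)%:E).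
  apply: (aa_mono h) => w _ + _ _; congr (I _ _ _ = _).
  apply/finset.setP => v; rewrite !finset.in_setD !finset.in_setI.
  by case: (v \in C); rewrite ?andbF.
move: Cc ne; rewrite mem_buckets => /existsP[u /eqP->] ne.
have /finset.set0Pn[a] := ne; rewrite finset.in_setI => /andP[au aA].
have AZ := fintype.subsetP (A_sub_Z X Y rep).
apply: (@integral_component _ _ _ _ _ _ df _ dD _ f_le
  (dag_ancestors D (Pa (component G u) G))).
- by move=> x v; exact: dag_ancestors_closed.
- move=> x v; rewrite finset.in_setI => /andP[vu vZ] xv.
  have xP : x \in Pa [set v] D by rewrite mem_Pa1.
  rewrite (PaD_component mpG rep vu) finset.in_setU in xP.
  rewrite finset.in_setU finset.in_setI; case/orP: xP => [->|xP]; first by rewrite orbT.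
  rewrite (fintype.subsetP (PaD_component_Z mpG rep dXY no_path vu vZ)) //.
  by move: xP; rewrite finset.in_setI => /andP[_ ->].
- move=> x v; rewrite finset.in_setI => /andP[vu _].
  by rewrite (mem_Pa_component mpG _ vu) => /andP[_ xv]; exact: (dirG_D rep).
- exact: sub_dag_ancestors.
- apply: disjointWr (dag_ancestors_Pa_component mpG rep u); exact: finset.subsetIl.
- by apply: finset.setIS; exact: A_sub_Z.
- by apply/finset.set0Pn; exists a; rewrite finset.in_setI au AZ.
Qed.

(** Each hypothesis holds almost everywhere on the slice; by [aa_fubini] it then holds, at almost
    every point, for almost all values of the coordinates over which it is integrated. *)
Lemma slice_identity w :
  aa (~: X) w (fun w' => do_density mu f D X w' = prodD (~: X) w') ->
  aa (~: X) w component_identity ->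
  aa (~: X) w (fun w' => I (~: X :\: Z) (EFin \o prodD (~: X)) w' = (prodD Z w')%:E) ->
  aa (~: X) w (fun w' => do_marginal mu f D X Y w' =
    I (A :\: Y) (EFin \o cond_prod mu f (bucket_factors G Bs)) w').
Proof.
move=> hdo hcomp hout.
have AZ : A \subset Z := A_sub_Z X Y rep.
have YA : Y \subset A by exact: Y_sub_A.
have ZX : Z \subset ~: X.
  by apply/fintype.subsetP => v vZ; rewrite inE (Z_notin_X dXY vZ).
have sXY : ~: (X :|: Y) \subset ~: X by rewrite finset.setCS finset.subsetUl.
have sZY : Z :\: Y \subset ~: X by apply: fintype.subset_trans ZX; exact: finset.subsetDl.
have sAY : A :\: Y \subset ~: X.
  by apply: fintype.subset_trans sZY; apply: finset.setSD.
have mP S : mnn (EFin \o prodD S) by exact: mnn_dag_prod.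
apply: (aa_mono (aa_and (aa_fubini sXY hdo)
  (aa_and (aa_fubini sZY hout) (aa_fubini sAY hcomp)))).
move=> w' _ [h1 [h2 h3]].
transitivity (I (~: (X :|: Y)) (EFin \o prodD (~: X)) w').
  apply: aa_eq_integral => //; first exact: mnn_do_density.
  by apply: (aa_mono h1) => w'' _ /= ->.
transitivity (I (Z :\: Y) (EFin \o prodD Z) w').
  have sub : ~: X :\: Z \subset ~: (X :|: Y).
    rewrite finset.setDE -finset.setCU finset.setCS; apply: finset.setUS.
    exact: fintype.subset_trans YA AZ.
  rewrite (integral_overD mu w' (mP _) sub).
  have -> : ~: (X :|: Y) :\: (~: X :\: Z) = Z :\: Y.
    apply/finset.setP => v; rewrite !(finset.in_setD, finset.in_setC, finset.in_setU).
    have := fintype.subsetP ZX v; rewrite finset.in_setC.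
    by case: (v \in Z); case: (v \in X); case: (v \in Y) => //= /(_ isT).
  apply: aa_eq_integral => //; exact: mnn_integral.
have sub : Z :\: A \subset Z :\: Y by exact: finset.setDS.
rewrite (integral_overD mu w' (mP _) sub).
have -> : (Z :\: Y) :\: (Z :\: A) = A :\: Y.
  apply/finset.setP => v; rewrite !finset.in_setD.
  have := fintype.subsetP AZ v.
  by case: (v \in Z); case: (v \in A); case: (v \in Y) => //= /(_ isT).
apply: aa_eq_integral => //; [exact: mnn_integral|exact: mnn_bucket_prod|].
apply: (aa_mono h3) => w'' _ hc; rewrite integral_outside_A /= bucket_prodE -big_enum /=.
rewrite (big_morph EFin (id1 := 1) (op1 := mule)) //; apply: eq_big_seq => C.
rewrite mem_enum => Cc; case: ifPn => [ne|/negPn/eqP e]; first exact: hc.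
by rewrite (Z_component_empty Cc e) finset.set0D integral_over0 /= /dag_prod big_set0.
Qed.

End Identification.

Theorem theorem3p6 (R : realType) (V : finType) (d : V -> measure_display)
  (T : forall v : V, measurableType (d v))
  (mu : forall v : V, {sigma_finite_measure set (T v) -> \bar R})
  (G : graph V) (X Y : {set V}) (f : values T -> R) (D : graph V)
  (Bs : seq {set V}) :
  mpdag G ->
  [disjoint X & Y] ->
  ~ (exists (x : V) (p : seq V),
       [/\ x \in X, last x p \in Y, possibly_causal G x p, proper_wrt X p
         & starts_undirected G x p]) ->
  consistent mu f G ->
  represented G D ->
  let A := An Y (induced_subgraph G (~: X)) in
  PCO A G Bs ->
  forall w0 : values T, almost_all mu [set: V] w0 (fun w =>
    almost_all mu (~: X) w (fun w' =>
      cond_prod_defined mu f (dag_factors D (~: X)) w' /\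
      cond_prod_defined mu f (bucket_factors G Bs) w') ->
    do_marginal mu f D X Y w =
      integral_over mu (A :\: Y)
        (fun w' => (cond_prod mu f (bucket_factors G Bs) w')%:E) w).
Proof.
move=> mpG dXY no_path [D' [rep' cons']] rep A pcoBs w0.
have [dD ea ec _] := rep; have [dD' ea' ec' _] := rep'; have [df _] := cons'.
have f_le : almost_all mu [set: V] w0 (fun w => f w <= dag_prod mu f D [set: V] w).
  apply: (density_le_dag_prod df dD w0 dD' _ _ cons').
    by move=> x y; rewrite ea ea'.
  by move=> x y z; rewrite ec ec'.
pose Z := avoiding_ancestors D X Y.
have hdo : almost_all mu [set: V] w0
    (fun w => do_density mu f D X w = dag_prod mu f D (~: X) w).
  (* For empty [X] the interventional density is [f] by convention, and the factorization of [f]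
     over [D] itself is called for. *)
  have [X0|nX] := eqVneq X finset.set0; last first.
    apply: aa_true => w _; rewrite /do_density (negbTE nX).
    exact: cond_prod_dag_factors.
  have cT : parent_closed D [set: V] by move=> u v _ _; rewrite inE.
  apply: (aa_mono (marginal_dag_prod df dD f_le cT)) => w _.
  rewrite /do_density X0 eqxx finset.setC0 /marginal finset.setCT integral_over0.
  exact: EFin_inj.
have hcomp := component_identity_ae df mpG rep dXY no_path f_le.
pose J w := integral_over mu (~: X :\: Z) (EFin \o dag_prod mu f D (~: X)) w.
pose E := [set w | J w <> (dag_prod mu f D Z w)%:E]%classic.
pose L := do_marginal mu f D X Y.
pose Q := integral_over mu (A :\: Y) (EFin \o cond_prod mu f (bucket_factors G Bs)).
have mL : mnn L by apply: mnn_integral; exact: mnn_do_density.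
have mQ : mnn Q by apply: mnn_integral; exact: mnn_bucket_prod.
have mJ : mnn J by apply: mnn_integral; exact: mnn_dag_prod.
have mE : measurable E by apply: measurable_ne => //; exact: mnn_dag_prod.
(* [K w = 0] says that on the slice of [w] the nodes outside [Z] integrate out almost everywhere.
   This condition follows from definedness, is measurable and is constant along the slice, so [Bad]
   can be shown to be null slice by slice. *)
pose K := integral_over mu (~: X) (indicator R E).
have mK : mnn K by apply: mnn_integral; exact: mnn_ind.
have m0 := mnn_cst T (lexx (0%E : \bar R)).
pose Bad := ([set w | K w = 0%E] `&` [set w | L w <> Q w])%classic.
have mBad : measurable Bad.
  by apply: measurableI; [exact: measurable_eq mK m0|exact: measurable_ne].
have hBad : almost_all mu [set: V] w0 (fun w => ~ Bad w).
  apply: (@aa_slices _ _ _ _ mu (~: X) w0 (EFin \o f)) => //.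
  - exact: mnn_density df.
  - by case: df => _ _ -> /eqP; rewrite onee_eq0.
  have sub := finset.subsetT (~: X).
  apply: (aa_mono (aa_and (aa_fubini sub hdo) (aa_fubini sub hcomp))) => w _ [h1 h2].
  have [K0|K0] := pselect (K w = 0%E); last first.
    apply: aa_true => w' a [/= K0' _]; apply: K0; rewrite -K0'.
    apply: (@dep_integral _ _ _ _ mu (~: X) [set: V]); first exact: dep_setT.
    by rewrite finset.setTD; exact: agree_sym.
  have h3 := proj2 (aa_measurable mu (~: X) w mE) K0.
  apply: (aa_mono (slice_identity df mpG rep dXY no_path pcoBs h1 h2 _)).
    by apply: (aa_mono h3) => w' _ /= /contrapT.
  by move=> w' _ e [_]; apply.
apply: (aa_mono hBad) => w _ nBad hdef; apply: contrapT => ne; apply: nBad; split=> //=.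
apply/(aa_measurable _ _ _ mE).
have ZX : Z \subset ~: X.
  by apply/fintype.subsetP => v vZ; rewrite inE (Z_notin_X dXY vZ).
have cl u v : v \in ~: X :\: Z -> u \in Z -> dir D v u = false.
  rewrite finset.in_setD finset.in_setC => /andP[vZ vX] uZ; apply/negP => vu.
  by case/negP: vZ; exact: (Z_closed dXY uZ vu vX).
have hd : almost_all mu (~: X) w (fun w' => cond_prod_defined mu f (dag_factors D (~: X)) w').
  by apply: (aa_mono hdef) => w' _ [].
apply: (aa_mono (integral_defined df dD ZX (fintype.subxx _) cl hd)) => w' _ e ne'.
exact: ne' e.
Qed.
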